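(* Fix a rank profile $\mathbf k=(k_1,\dots,k_q)$ and let $(F_\ell,y_\ell,\rho_\ell)_{\ell\ge0}$ be a sequence generated by the fixed-rank augmented Lagrangian method satisfying the fixed-rank ALM conditions (A1)--(A4) listed in the context. Then every accumulation point $F_\star$ of the accepted factor sequence $(F_\ell)$ is feasible, $c(F_\star)=0$, and is a second-order critical point of the fixed-rank Burer--Monteiro problem at profile $\mathbf k$: $$S_{B,c}(F_\star)F_{\star,c}=0\ (c\in[q]),\qquad \sum_{c=1}^q\langle U_c,S_{B,c}(F_\star)U_c\rangle\ge0\ \text{ for every }U\in\ker Dc(F_\star).$$ Suppose in addition that for every $c\in[q]$, $k_c\ge n_c$ or $\tau(k_c)>r_c$. Then there is a Lebesgue-null exceptional set $\mathcal E_{\mathbf k}\subset\prod_c\mathbb S^{n_c}$, depending only on $(\mathcal A_c)_c$, $b$ and $\mathbf k$, outside of which every second-order critical point of the fixed-rank problem is globally optimal for the product SDP, and such that whenever the product cost satisfies $C=(C_c)_c\notin\mathcal E_{\mathbf k}$, every accumulation point $F_\star$ is globally optimal for the product SDP (i.e. $(F_{\star,c}F_{\star,c}^\top)_c$ is an optimal solution), and $$g(F_\ell)\to p_\star,\qquad \operatorname{dist}\bigl((F_{\ell,c}F_{\ell,c}^\top)_c,\ \mathcal X^\star\bigr)\to0,$$ where $p_\star$ is the optimal value and $\mathcal X^\star$ the solution set of the product SDP. If $k_c\ge n_c$ for every block, this conclusion holds for every product cost.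
   Context: Let $q,m,n_1,\dots,n_q,k_1,\dots,k_q$ be positive integers, $[q]=\{1,\dots,q\}$, $\mathbb S^n$ the real symmetric $n\times n$ matrices. Fix $b\in\mathbb R^m$, $C_c\in\mathbb S^{n_c}$ and linear maps $\mathcal A_c:\mathbb S^{n_c}\to\mathbb R^m$ with adjoints $\mathcal A_c^*$. Let $r_c:=\operatorname{rank}(\mathcal A_c)$, $\tau(k):=k(k+1)/2$. The product SDP is $\min\sum_c\langle C_c,X_c\rangle$ s.t. $\sum_c\mathcal A_c(X_c)=b$, $X_c\succeq0$ $(c\in[q])$. Put $S_c(y):=C_c-\mathcal A_c^*(y)$. Factors: $F=(F_c)_c$, $F_c\in\mathbb R^{n_c\times k_c}$, with direct-sum inner product $\sum_c\langle F_c,U_c\rangle$ and norm $\|\cdot\|_\oplus$. Set $g(F):=\sum_c\langle C_c,F_cF_c^\top\rangle$, $c(F):=\sum_c\mathcal A_c(F_cF_c^\top)-b$, $\mathcal M_{\mathbf k}:=\{F:c(F)=0\}$, $Dc(F)[U]=\sum_c\mathcal A_c(F_cU_c^\top+U_cF_c^\top)$. The fixed-rank Burer--Monteiro problem is $\min g(F)$ s.t. $c(F)=0$. Let $\mathcal B_F\nu:=(\mathcal A_c^*(\nu)F_c)_c$, $G(F):=\mathcal B_F^*\mathcal B_F$, $C_F:=(C_cF_c)_c$, $\mu_B(F):=G(F)^\dagger\mathcal B_F^*C_F$ (Moore--Penrose pseudoinverse) and $S_{B,c}(F):=C_c-\mathcal A_c^*(\mu_B(F))$. A factor $F\in\mathcal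 M_{\mathbf k}$ is a second-order critical point if $S_{B,c}(F)F_c=0$ for all $c$ and $\sum_c\langle U_c,S_{B,c}(F)U_c\rangle\ge0$ for all $U\in\ker Dc(F)$. Factored augmented Lagrangian: $\Phi_{\rho,y}(F):=g(F)-\langle y,c(F)\rangle+\frac\rho2\|c(F)\|_2^2$, with gradient and Hessian taken in the full Euclidean direct-sum factor space. Iteration: given $(F_\ell,y_\ell,\rho_\ell)$, an inner solver warm-started at $F_\ell$ returns an accepted output $F_{\ell+1}$ of $\min_F\Phi_{\rho_\ell,y_\ell}(F)$; then $y_{\ell+1}=y_\ell-\rho_\ell c(F_{\ell+1})$. Constants $0<\theta<1$, $\gamma_\rho>1$ are fixed; the (uncapped) penalty rule is $\rho_{\ell+1}=\rho_\ell$ if $\|c(F_{\ell+1})\|_2\le\theta\|c(F_\ell)\|_2$, and $\rho_{\ell+1}=\gamma_\rho\rho_\ell$ otherwise. No finite stopping test is applied. Fixed-rank ALM conditions: (A1) $\mathcal M_{\mathbf k}$ is nonempty, the feasible set of the product SDP is compact, and the accepted factors $F_\ell$ and the relevant inner level sets $\{F:\Phi_{\rho_\ell,y_\ell}(F)\le\Phi_{\rho_\ell,y_\ell}(F_\ell)\}$ lie in a common compact set. (A2) There is an open neighborhood of $\mathcal M_{\mathbf k}$ on which $F\mapsto Dc(F)$ has constant rank. (A3) For every $\ell$, $\|\nabla\Phi_{\rho_\ell,y_\ell}(F_{\ell+1})\|_\oplus\le\omega_\ell$ and $\lambda_{\min}(\nabla^2\Phi_{\rho_\ell,y_\ell}(F_{\ell+1}))\ge-\zeta_\ell$,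 with $\omega_\ell\to0$ and $\zeta_\ell\to0$. (A4) $\rho_0>0$, the multipliers $(y_\ell)$ are bounded, and the penalty rule above is used. *)

(* Defs.v *)
From HB Require Import structures.
From mathcomp Require Import all_boot all_order all_algebra.
From mathcomp Require Import all_classical all_reals all_analysis.
Import numFieldNormedType.Exports.
Set Implicit Arguments.
Unset Strict Implicit.
Unset Printing Implicit Defensive.
Import Order.TTheory GRing.Theory Num.Theory.
Local Open Scope classical_set_scope.
Local Open Scope ring_scope.

(* Vectors of R^m are rows. *)

Section Euclidean.
Context {R : realType}.

Definition frob m n (U V : 'M[R]_(m, n)) : R := \tr (U^T *m V).

Definition fnorm m n (U : 'M[R]_(m, n)) : R := Num.sqrt (frob U U).

Lemma frobE m n (U V : 'M[R]_(m, n)) : frob U V = \sum_i \sum_j U i j * V i j.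
Proof.
rewrite /frob /mxtrace exchange_big; apply: eq_bigr => j _.
by rewrite mxE; apply: eq_bigr => i _; rewrite mxE.
Qed.

Lemma frob_row n (u v : 'rV[R]_n) : frob u v = (u *m v^T) 0 0.
Proof.
by rewrite frobE big_ord1 mxE; apply: eq_bigr => i _; rewrite !mxE.
Qed.

Definition gradient N (f : 'rV[R]_N -> R) (x : 'rV[R]_N) : 'rV[R]_N :=
  \row_j 'D_(delta_mx 0 j) f x.

Definition hessian N (f : 'rV[R]_N -> R) (x : 'rV[R]_N) : 'M[R]_N :=
  \matrix_(i, j) 'D_(delta_mx 0 i) ('D_(delta_mx 0 j) f) x.

(* For the symmetric matrices of positive size considered below the set of
   eigenvalues is finite and nonempty, and the infimum is a minimum. *)
Definition lambda_min N (H : 'M[R]_N) : R := inf [set a | eigenvalue H a].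

Definition moore_penrose m n (M : 'M[R]_(m, n)) (P : 'M[R]_(n, m)) : Prop :=
  [/\ M *m P *m M = M, P *m M *m P = P,
      (M *m P)^T = M *m P & (P *m M)^T = P *m M].

(* From the full-rank factorization M = col_base M *m row_base M. *)
Definition mpinv m n (M : 'M[R]_(m, n)) : 'M[R]_(n, m) :=
  let L := col_base M in let Q := row_base M in
  Q^T *m invmx (Q *m Q^T) *m invmx (L^T *m L) *m L^T.

Lemma row_free_gram m n (Q : 'M[R]_(m, n)) :
  row_free Q -> Q *m Q^T \in unitmx.
Proof.
move=> Qf; rewrite -row_free_unit -kermx_eq0; apply/eqP/row_matrixP => i.
rewrite row0; set x := row i _.
have xQQ : x *m (Q *m Q^T) = 0.
  by rewrite /x -row_mul mulmx_ker row0.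
have : (x *m Q) *m (x *m Q)^T = 0.
  by rewrite trmx_mul mulmxA -[x *m Q *m _]mulmxA xQQ mul0mx.
move=> /matrixP/(_ 0 0); rewrite -frob_row mxE frobE big_ord1 => /eqP.
rewrite psumr_eq0 => [/allP h|j _]; last by rewrite -expr2 sqr_ge0.
apply: (row_free_inj Qf); rewrite mul0mx; apply/rowP => j.
rewrite [RHS]mxE; apply/eqP.
by have := h j (mem_index_enum j); rewrite /= mulf_eq0 orbb.
Qed.

Lemma full_rank_moore_penrose m r n (L : 'M[R]_(m, r)) (Q : 'M[R]_(r, n)) :
  row_full L -> row_free Q ->
  moore_penrose (L *m Q)
    (Q^T *m invmx (Q *m Q^T) *m invmx (L^T *m L) *m L^T).
Proof.
move=> Lf /row_free_gram QU.
have LU : L^T *m L \in unitmx.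
  rewrite -[X in _ *m X]trmxK; apply: row_free_gram.
  by rewrite /row_free mxrank_tr.
have trQ : (invmx (Q *m Q^T))^T = invmx (Q *m Q^T).
  by rewrite trmx_inv trmx_mul trmxK.
have trL : (invmx (L^T *m L))^T = invmx (L^T *m L).
  by rewrite trmx_inv trmx_mul trmxK.
set P := (X in moore_penrose _ X).
have MP : L *m Q *m P = L *m invmx (L^T *m L) *m L^T.
  by rewrite /P !mulmxA -[L *m Q *m _]mulmxA mulmxK.
have PM : P *m (L *m Q) = Q^T *m invmx (Q *m Q^T) *m Q.
  by rewrite /P !mulmxA -[_ *m L^T *m L]mulmxA mulmxKV.
split.
- by rewrite MP !mulmxA -[_ *m L^T *m L]mulmxA mulmxKV.
- by rewrite PM {1}/P !mulmxA -[_ *m Q *m Q^T]mulmxA mulmxKV.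
- by rewrite MP !trmx_mul trmxK trL mulmxA.
- by rewrite PM !trmx_mul trmxK trQ mulmxA.
Qed.

Lemma mpinvP m n (M : 'M[R]_(m, n)) : moore_penrose M (mpinv M).
Proof.
have := full_rank_moore_penrose (col_base_full M) (row_base_free M).
by rewrite mulmx_base.
Qed.

Lemma moore_penrose_uniq m n (M : 'M[R]_(m, n)) (P P' : 'M[R]_(n, m)) :
  moore_penrose M P -> moore_penrose M P' -> P = P'.
Proof.
move=> [a1 a2 a3 a4] [b1 b2 b3 b4].
have h1 : M *m P = M *m P'.
  rewrite -a3 -{1}b1 -mulmxA trmx_mul a3 b3.
  by rewrite !mulmxA a1.
have h2 : P *m M = P' *m M.
  rewrite -a4 -{1}b1 !mulmxA -mulmxA trmx_mul a4 b4.
  by rewrite -!mulmxA !(mulmxA M) a1.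
by rewrite -a2 -mulmxA h1 mulmxA h2 b2.
Qed.

End Euclidean.

(* Block families (X_c)_c, X_c of size p c x r c, are stored as one row vector,
   which carries the topology, norm and derivatives of a Euclidean space. *)
Notation blocks R p r := 'rV[R]_(\sum_c (p c * r c)%N).

Section Blocks.
Context {R : realType} {q : nat} {p r : 'I_q -> nat}.

Definition blk (c : 'I_q) (X : blocks R p r) : 'M[R]_(p c, r c) :=
  vec_mx (submxrow X c).

Definition pack (X : forall c, 'M[R]_(p c, r c)) : blocks R p r :=
  \mxrow_c mxvec (X c).

Lemma blkK (X : blocks R p r) : pack (blk^~ X) = X.
Proof.
rewrite -[RHS]submxrowK; apply/eq_mxrow => c; exact: vec_mxK.
Qed.

Lemma packK (X : forall c, 'M[R]_(p c, r c)) c : blk c (pack X) = X c.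
Proof. by rewrite /blk mxrowK mxvecK. Qed.

Lemma blk_is_linear c : linear (blk c).
Proof.
move=> a X Y; rewrite /blk -linearP; congr vec_mx.
by apply/rowP => j; rewrite !mxE.
Qed.

HB.instance Definition _ c :=
  GRing.isLinear.Build R (blocks R p r) 'M[R]_(p c, r c) _ (blk c)
    (blk_is_linear c).

Lemma frob_blocks (X Y : blocks R p r) :
  frob X Y = \sum_c frob (blk c X) (blk c Y).
Proof.
rewrite -[X in frob X _]blkK -[Y in frob _ Y]blkK frob_row.
rewrite /pack tr_mxrow mul_mxrow_mxcol summxE; apply: eq_bigr => c _.
rewrite mxE frobE pair_bigA /= (reindex _ (curry_mxvec_bij _ _)) /=.
by apply: eq_bigr => -[i j] _; rewrite mxE !mxvecE.
Qed.

End Blocks.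

Section SymmetricMatrices.
Context {R : realType}.

Definition symV n : {vspace 'M[R]_n} := lker (\1%VF - linfun (@trmx R n n)).

Lemma memv_symV n (X : 'M[R]_n) : X \in symV n <-> X^T = X.
Proof.
rewrite memv_ker add_lfunE opp_lfunE id_lfunE lfunE /= subr_eq0.
by split=> [/eqP|->].
Qed.

End SymmetricMatrices.

Notation sym R n := (subvs_of (@symV R n)).

Section SymmetricOperations.
Context {R : realType}.

Lemma gram_subproof n k (F : 'M[R]_(n, k)) : F *m F^T \in symV n.
Proof. by apply/memv_symV; rewrite trmx_mul trmxK. Qed.

Definition gram n k (F : 'M[R]_(n, k)) : sym R n := Subvs (gram_subproof F).

Lemma dgram_subproof n k (F U : 'M[R]_(n, k)) :
  F *m U^T + U *m F^T \in symV n.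
Proof. by apply/memv_symV; rewrite linearD /= !trmx_mul !trmxK addrC. Qed.

Definition dgram n k (F U : 'M[R]_(n, k)) : sym R n :=
  Subvs (dgram_subproof F U).

Lemma symmetrize_subproof n (M : 'M[R]_n) : 2^-1 *: (M + M^T) \in symV n.
Proof. by apply/memv_symV; rewrite linearZ linearD /= trmxK [M^T + _]addrC. Qed.

Definition symmetrize n (M : 'M[R]_n) : sym R n :=
  Subvs (symmetrize_subproof M).

Lemma adjoint_subproof n m (A : 'Hom(sym R n, 'rV[R]_m)) (y : 'rV[R]_m) :
  \matrix_(i, j) frob y (A (symmetrize (delta_mx i j))) \in symV n.
Proof.
apply/memv_symV/matrixP => i j; rewrite !mxE; congr (frob y (A _)).
by apply: subvs_inj => /=; rewrite !trmx_delta addrC.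
Qed.

Definition adjoint n m (A : 'Hom(sym R n, 'rV[R]_m)) (y : 'rV[R]_m) :
    sym R n :=
  Subvs (adjoint_subproof A y).

Lemma adjointP n m (A : 'Hom(sym R n, 'rV[R]_m)) (y : 'rV[R]_m) (X : sym R n) :
  frob (vsval (adjoint A y)) (vsval X) = frob y (A X).
Proof.
have XT : (vsval X)^T = vsval X by apply/memv_symV/subvsP.
have {2}-> : X = \sum_i \sum_j vsval X i j *: symmetrize (delta_mx i j).
  apply: subvs_inj.
  set T := \sum_i _.
  suff -> : vsval T = 2^-1 *: (vsval X + (vsval X)^T).
    by rewrite XT -mulr2n -(scaler_nat 2 (vsval X)) scalerA mulVf ?scale1r // pnatr_eq0.
  rewrite [vsval X]matrix_sum_delta {}/T !linear_sum /= -big_split /=.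
  rewrite scaler_sumr; apply: eq_bigr => i _.
  rewrite !linear_sum /= -big_split /= scaler_sumr; apply: eq_bigr => j _.
  by rewrite [(_ *: delta_mx i j)^T]linearZ /= -scalerDr scalerA mulrC -scalerA.
rewrite linear_sum /frob linear_sum /= linear_sum /= -/(frob _ _) frobE.
apply: eq_bigr => i _; rewrite !linear_sum /=; apply: eq_bigr => j _.
by rewrite !linearZ /= mxE mulrC.
Qed.

Definition psd n (X : sym R n) : Prop :=
  forall v : 'cV[R]_n, 0 <= (v^T *m vsval X *m v) 0 0.

End SymmetricOperations.

Section ProductSDP.
Context {R : realType} {q m : nat} {n : 'I_q -> nat}.
Variables (A : forall c, 'Hom(sym R (n c), 'rV[R]_m)) (b : 'rV[R]_m).
Variable C : forall c, sym R (n c).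

Definition sdp_feasible : set (forall c, sym R (n c)) :=
  [set X | (forall c, psd (X c)) /\ \sum_c A c (X c) = b].

Definition sdp_cost (X : forall c, sym R (n c)) : R :=
  \sum_c frob (vsval (C c)) (vsval (X c)).

Definition sdp_value : R := inf [set sdp_cost X | X in sdp_feasible].

Definition sdp_optimal : set (forall c, sym R (n c)) :=
  [set X | sdp_feasible X /\
           forall Y, sdp_feasible Y -> sdp_cost X <= sdp_cost Y].

Definition pack_sym (X : forall c, sym R (n c)) : blocks R n n :=
  pack (fun c => vsval (X c)).

Definition sdp_dist (X : forall c, sym R (n c))
    (S : set (forall c, sym R (n c))) : R :=
  inf [set fnorm (pack_sym X - pack_sym Y) | Y in S].

Definition slack (y : 'rV[R]_m) (c : 'I_q) : sym R (n c) :=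
  C c - adjoint (A c) y.

End ProductSDP.

(* Lebesgue outer measure zero, by countable covers with coordinate boxes.  The
   coordinates of a symmetric matrix are its entries (i, j) with i <= j. *)
Section LebesgueNull.
Context {R : realType} {q : nat} {n : 'I_q -> nat}.

Definition sym_box (lo hi : forall c, 'M[R]_(n c)) :
    set (forall c, sym R (n c)) :=
  [set X | forall c (i j : 'I_(n c)), (i <= j)%N ->
    lo c i j <= (vsval (X c) : 'M[R]_(n c)) i j <= hi c i j].

Definition sym_box_volume (lo hi : forall c, 'M[R]_(n c)) : R :=
  \prod_c \prod_(i < n c) \prod_(j < n c | (i <= j)%N) (hi c i j - lo c i j).

Definition lebesgue_null (E : set (forall c, sym R (n c))) : Prop :=
  forall e : R, 0 < e ->
  exists lo hi : nat -> forall c, 'M[R]_(n c),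
    [/\ forall l c (i j : 'I_(n c)), (i <= j)%N -> lo l c i j <= hi l c i j,
        E `<=` \bigcup_l sym_box (lo l) (hi l) &
        (\sum_(0 <= l <oo) (sym_box_volume (lo l) (hi l))%:E <= e%:E)%E].

End LebesgueNull.

Section BurerMonteiro.
Context {R : realType} {q m : nat} {n k : 'I_q -> nat}.
Variables (A : forall c, 'Hom(sym R (n c), 'rV[R]_m)) (b : 'rV[R]_m).
Variable C : forall c, sym R (n c).
Implicit Types (F U : blocks R n k) (y nu : 'rV[R]_m).

Definition bm_gram F (c : 'I_q) : sym R (n c) := gram (blk c F).

Definition bm_cost F : R := sdp_cost C (bm_gram F).

Definition bm_constr F : 'rV[R]_m := \sum_c A c (gram (blk c F)) - b.

Definition bm_feasible : set (blocks R n k) := [set F | bm_constr F = 0].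

Definition bm_Dconstr F U : 'rV[R]_m :=
  \sum_c A c (dgram (blk c F) (blk c U)).

Definition bm_B F nu : blocks R n k :=
  pack (fun c => vsval (adjoint (A c) nu) *m blk c F).

Lemma bm_Dconstr_is_linear F : linear (bm_Dconstr F).
Proof.
move=> a U V; rewrite /bm_Dconstr scaler_sumr -big_split /=.
apply: eq_bigr => c _; rewrite -linearP; congr (A c _).
apply: subvs_inj; rewrite [RHS]linearP /=.
have -> : blk c (a *: U + V) = a *: blk c U + blk c V by exact: linearP.
rewrite [(_ + _)^T]linearP /= mulmxDr mulmxDl -scalemxAr -scalemxAl scalerDr.
by rewrite -!addrA; congr (_ + _); rewrite addrCA.
Qed.

HB.instance Definition _ F :=
  GRing.isLinear.Build R (blocks R n k) 'rV[R]_m _ (bm_Dconstr F)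
    (bm_Dconstr_is_linear F).

Lemma bm_B_is_linear F : linear (bm_B F).
Proof.
move=> a y nu; rewrite -[LHS]blkK -[RHS]blkK; congr pack.
apply: functional_extensionality_dep => c.
rewrite linearP /= !packK scalemxAl -mulmxDl; congr (_ *m _).
apply/matrixP => i j; rewrite !mxE /frob !linearP /=.
by rewrite mulmxDl -scalemxAl linearP.
Qed.

HB.instance Definition _ F :=
  GRing.isLinear.Build R 'rV[R]_m (blocks R n k) _ (bm_B F) (bm_B_is_linear F).

(* lin1_mx f is the matrix of f acting on rows: f u = u *m lin1_mx f. *)
Definition bm_rank F : nat := \rank (lin1_mx (bm_Dconstr F)).

Definition bm_Badj F U : 'rV[R]_m := U *m (lin1_mx (bm_B F))^T.

Lemma bm_BadjP F nu U : frob (bm_B F nu) U = frob nu (bm_Badj F U).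
Proof.
by rewrite !frob_row /bm_Badj trmx_mul trmxK mulmxA mul_rV_lin1.
Qed.

Definition bm_G F : 'M[R]_m := lin1_mx (bm_Badj F \o bm_B F).

Definition bm_CF F : blocks R n k := pack (fun c => vsval (C c) *m blk c F).

(* G^+ B^* C_F; the symmetric matrix G^+ acts on rows from the right. *)
Definition bm_mu F : 'rV[R]_m := bm_Badj F (bm_CF F) *m mpinv (bm_G F).

Definition bm_slack F (c : 'I_q) : sym R (n c) := slack A C (bm_mu F) c.

Definition second_order_critical F : Prop :=
  [/\ bm_constr F = 0,
      forall c, vsval (bm_slack F c) *m blk c F = 0 &
      forall U, bm_Dconstr F U = 0 ->
        0 <= \sum_c frob (blk c U) (vsval (bm_slack F c) *m blk c U)].

Definition aug_lagrangian (rho : R) y F : R :=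
  bm_cost F - frob y (bm_constr F) + rho / 2 * fnorm (bm_constr F) ^+ 2.

End BurerMonteiro.

Section AugmentedLagrangianMethod.
Context {R : realType} {q m : nat} {n k : 'I_q -> nat}.
Variables (A : forall c, 'Hom(sym R (n c), 'rV[R]_m)) (b : 'rV[R]_m).
Variable C : forall c, sym R (n c).
Variables (theta gamma : R) (omega zeta : nat -> R).
Variables (F : nat -> blocks R n k) (y : nat -> 'rV[R]_m) (rho : nat -> R).

Local Notation cF l := (bm_constr A b (F l)).
Local Notation Phi l := (aug_lagrangian A b C (rho l) (y l)).

Definition multiplier_update : Prop :=
  forall l, y l.+1 = y l - rho l *: cF l.+1.

Definition penalty_rule : Prop :=
  forall l, rho l.+1 =
    if fnorm (cF l.+1) <= theta * fnorm (cF l) then rho l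
    else gamma * rho l.

Definition alm_compactness : Prop :=
  [/\ (bm_feasible A b : set (blocks R n k)) !=set0,
      compact [set pack_sym X | X in sdp_feasible A b] &
      exists K : set (blocks R n k), [/\ compact K, forall l, K (F l) &
        forall l, [set G | Phi l G <= Phi l (F l)] `<=` K]].

Definition constant_rank : Prop :=
  exists O : set (blocks R n k), [/\ open O, bm_feasible A b `<=` O &
    exists r, forall G, O G -> bm_rank A G = r].

Definition inner_accuracy : Prop :=
  [/\ forall l, fnorm (gradient (Phi l) (F l.+1)) <= omega l,
      forall l, - zeta l <= lambda_min (hessian (Phi l) (F l.+1)),
      omega @ \oo --> (0 : R) & zeta @ \oo --> (0 : R)].

Definition bounded_multipliers : Prop :=
  exists M : R, forall l, fnorm (y l) <= M.

Record fixed_rank_alm : Prop := FixedRankALM {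
  alm_theta : 0 < theta < 1;
  alm_gamma : 1 < gamma;
  alm_update : multiplier_update;
  alm_A1 : alm_compactness;
  alm_A2 : constant_rank;
  alm_A3 : inner_accuracy;
  alm_A4 : [/\ 0 < rho 0%N, bounded_multipliers & penalty_rule] }.

Definition accumulation_point (G : blocks R n k) : Prop := cluster (F @ \oo) G.

Definition sdp_convergence : Prop :=
  [/\ forall G, accumulation_point G -> sdp_optimal A b C (bm_gram G),
      (fun l => bm_cost C (F l)) @ \oo --> sdp_value A b C &
      (fun l => sdp_dist (bm_gram (F l)) (sdp_optimal A b C)) @ \oo -->
        (0 : R)].

End AugmentedLagrangianMethod.

Definition tau (k : nat) : nat := (k * k.+1) %/ 2.

(* Main.v *)
Require Import Defs.
From HB Require Import structures.
From mathcomp Require Import all_boot all_order all_algebra.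
From mathcomp Require Import all_classical all_reals all_analysis.
From mathcomp Require Import ring lra.
Import numFieldNormedType.Exports.
Import Order.TTheory GRing.Theory Num.Theory.
Set Implicit Arguments.
Unset Strict Implicit.
Unset Printing Implicit Defensive.
Local Open Scope classical_set_scope.
Local Open Scope ring_scope.

(** The argument has three parts.

    The limit points.  The factored problem has a quadratic objective and
    quadratic constraints: with symmetric bilinear [K] and [D], the objective is
    [K x x / 2] and the constraints are [D x x / 2 - b].  The multiplier update
    turns the gradient and the Hessian of the augmented Lagrangian at the
    accepted point into the Lagrangian form [qlag] of the new multiplier, plus
    [rho |D x v|^2] for the Hessian.  Feasibility holds in the limit because
    [rho l * c (x l.+1)] is a difference of bounded multipliers
    ([penalty_feasible]).  Along an ultrafilter that realizes the accumulation
    point the bounded multipliers converge as well, and the first-order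
    residual passes to the limit.  For the curvature, constant rank makes the
    kernels of the Jacobians vary continuously ([kernel_lift]): a kernel
    direction at the limit is approached by kernel directions at the iterates,
    along which the penalty term, whose weight may blow up, vanishes
    ([qaug_limit]).  The limit multiplier and the pseudoinverse multiplier
    differ by a covector that annihilates the range of the Jacobian, and constant
    rank also forces the curvature of the constraints along kernel directions
    into that range ([constant_rank_curvature]); so the curvature condition does
    not depend on which stationary multiplier is used.

    Global optimality.  A factor block with dependent columns leaves the
    direction [v z^T] free, which makes the slack of the block positive
    semidefinite; an invertible block makes it 0.  Positive semidefinite slacks
    that are complementary to the Gram matrices are a dual certificate
    ([critical_optimal]).  A block with independent columns and fewer columns
    than rows requires a cost of the form [A^* y + S], with [S] of corank at
    least k.  Matrices [S] of this kind depend on [tau n - tau k] parameters and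
    [A^* y] on r of them, so when [tau k > r] such costs are contained in
    countably many Lipschitz images of bounded sets of smaller dimension, and
    form a null set ([stratum_null], [exceptional_costs_null]).

    Convergence.  The iterates stay in a compact set and all their accumulation
    points are optimal, so the continuous functions cost and distance to the
    solution set tend to their values at optimal points
    ([accumulation_optimal_convergence]). *)

(** * The Frobenius inner product *)

Section Frobenius.
Context {R : realType}.

Lemma frob_ge0 m n (U : 'M[R]_(m, n)) : 0 <= frob U U.
Proof.
by rewrite frobE; do 2!apply: sumr_ge0 => ? _; rewrite -expr2 sqr_ge0.
Qed.

Lemma frob_eq0 m n (U : 'M[R]_(m, n)) : frob U U = 0 -> U = 0.
Proof.
move=> /eqP; rewrite frobE psumr_eq0 => [/allP h|i _]; last first.
  by apply: sumr_ge0 => j _; rewrite -expr2 sqr_ge0.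
apply/matrixP => i j; rewrite mxE; apply/eqP.
have := h i (mem_index_enum i); rewrite /= psumr_eq0 => [/allP h'|? _].
  by have := h' j (mem_index_enum j); rewrite /= mulf_eq0 orbb.
by rewrite -expr2 sqr_ge0.
Qed.

Lemma fnorm_sqr m n (U : 'M[R]_(m, n)) : fnorm U ^+ 2 = frob U U.
Proof. by rewrite sqr_sqrtr // frob_ge0. Qed.

Lemma fnorm_ge0 m n (U : 'M[R]_(m, n)) : 0 <= fnorm U.
Proof. exact: sqrtr_ge0. Qed.

Lemma entry_le_fnorm m n (U : 'M[R]_(m, n)) i j : `|U i j| <= fnorm U.
Proof.
rewrite -(@ler_pXn2r _ 2) ?nnegrE ?fnorm_ge0 // fnorm_sqr frobE.
rewrite (bigD1 i) //= (bigD1 j) //= real_normK ?num_real // expr2.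
rewrite -addrA lerDl; apply: addr_ge0; last apply: sumr_ge0 => ? _;
  by apply: sumr_ge0 => ? _; rewrite -expr2 sqr_ge0.
Qed.

Lemma frobC m n (U V : 'M[R]_(m, n)) : frob U V = frob V U.
Proof. by rewrite !frobE; do 2!apply: eq_bigr => ? _; rewrite mulrC. Qed.

Lemma frobDl m n (U V W : 'M[R]_(m, n)) : frob (U + V) W = frob U W + frob V W.
Proof. by rewrite /frob linearD mulmxDl linearD. Qed.

Lemma frobZl m n a (U V : 'M[R]_(m, n)) : frob (a *: U) V = a * frob U V.
Proof. by rewrite /frob linearZ -scalemxAl linearZ. Qed.

Lemma frobDr m n (U V W : 'M[R]_(m, n)) : frob W (U + V) = frob W U + frob W V.
Proof. by rewrite !(frobC W) frobDl. Qed.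

Lemma frobZr m n a (U V : 'M[R]_(m, n)) : frob U (a *: V) = a * frob U V.
Proof. by rewrite !(frobC U) frobZl. Qed.

Lemma frob0r m n (U : 'M[R]_(m, n)) : frob U 0 = 0.
Proof. by rewrite /frob mulmx0 linear0. Qed.

Lemma frobNl m n (U V : 'M[R]_(m, n)) : frob (- U) V = - frob U V.
Proof. by rewrite -scaleN1r frobZl mulN1r. Qed.

Lemma frobBl m n (U V W : 'M[R]_(m, n)) : frob (U - V) W = frob U W - frob V W.
Proof. by rewrite frobDl frobNl. Qed.

Lemma frobBr m n (U V W : 'M[R]_(m, n)) : frob W (U - V) = frob W U - frob W V.
Proof. by rewrite !(frobC W) frobBl. Qed.

Lemma frob_sumr (I : Type) (r : seq I) (P : pred I) p s (X : 'M[R]_(p, s))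
    (Y : I -> 'M[R]_(p, s)) :
  frob X (\sum_(i <- r | P i) Y i) = \sum_(i <- r | P i) frob X (Y i).
Proof. by rewrite /frob mulmx_sumr linear_sum. Qed.

Lemma frob_mulmxr N (x z : 'rV[R]_N) (H : 'M[R]_N) :
  H^T = H -> frob (x *m H) z = frob x (z *m H).
Proof.
move=> Hs; rewrite !frob_row !trmx_mul Hs mulmxA.
by congr (_ 0 0).
Qed.

End Frobenius.

(** * Entrywise limits of matrices and persistence of kernels *)

Section EntrywiseLimits.
Context {R : realType} {T : Type} (G : set_system T) {FG : Filter G}.

Lemma cvg_sumr (I : Type) (r : seq I) (P : pred I) (f : I -> T -> R)
    (l : I -> R) :
  (forall i, P i -> f i t @[t --> G] --> l i) ->
  (\sum_(i <- r | P i) f i t) @[t --> G] --> \sum_(i <- r | P i) l i.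
Proof. by move=> fl; apply: cvg_big => //; exact: add_continuous. Qed.

Lemma cvg_prodr (I : Type) (r : seq I) (P : pred I) (f : I -> T -> R)
    (l : I -> R) :
  (forall i, P i -> f i t @[t --> G] --> l i) ->
  (\prod_(i <- r | P i) f i t) @[t --> G] --> \prod_(i <- r | P i) l i.
Proof. by move=> fl; apply: cvg_big => //; exact: mul_continuous. Qed.

(** Entrywise, so that the algebra of matrices does not involve a topology on
    rectangular matrices. *)
Definition mcvg p q (M : T -> 'M[R]_(p, q)) (M0 : 'M[R]_(p, q)) :=
  forall i j, M t i j @[t --> G] --> M0 i j.

Lemma cvg_mcvg p q (M : T -> 'M[R]_(p, q)) (M0 : 'M[R]_(p, q)) :
  M t @[t --> G] --> M0 -> mcvg M M0.
Proof.
move=> cM i j.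
exact: (cvg_comp M (fun X : 'M[R]_(p, q) => X i j) cM
  (@coord_continuous R p q i j M0)).
Qed.

Lemma mcvg_cst p q (M0 : 'M[R]_(p, q)) : mcvg (fun=> M0) M0.
Proof. by move=> i j; exact: cvg_cst. Qed.

Lemma mcvgD p q (M N : T -> 'M[R]_(p, q)) M0 N0 :
  mcvg M M0 -> mcvg N N0 -> mcvg (fun t => M t + N t) (M0 + N0).
Proof.
move=> cM cN i j; rewrite mxE; under eq_cvg do rewrite mxE.
by apply: cvgD; [exact: cM|exact: cN].
Qed.

Lemma mcvgN p q (M : T -> 'M[R]_(p, q)) M0 :
  mcvg M M0 -> mcvg (fun t => - M t) (- M0).
Proof.
move=> cM i j; rewrite mxE; under eq_cvg do rewrite mxE.
by apply: cvgN; exact: cM.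
Qed.

Lemma mcvgB p q (M N : T -> 'M[R]_(p, q)) M0 N0 :
  mcvg M M0 -> mcvg N N0 -> mcvg (fun t => M t - N t) (M0 - N0).
Proof. by move=> cM cN; apply: mcvgD => //; exact: mcvgN. Qed.

Lemma mcvgM p q r (M : T -> 'M[R]_(p, q)) (N : T -> 'M[R]_(q, r)) M0 N0 :
  mcvg M M0 -> mcvg N N0 -> mcvg (fun t => M t *m N t) (M0 *m N0).
Proof.
move=> cM cN i j; rewrite mxE; under eq_cvg do rewrite mxE.
by apply: cvg_sumr => k _; apply: cvgM; [exact: cM|exact: cN].
Qed.

Lemma mcvgZ p q (a : T -> R) (M : T -> 'M[R]_(p, q)) (a0 : R) M0 :
  a t @[t --> G] --> a0 -> mcvg M M0 -> mcvg (fun t => a t *: M t) (a0 *: M0).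
Proof.
move=> ca cM i j; rewrite mxE; under eq_cvg do rewrite mxE.
by apply: cvgM => //; exact: cM.
Qed.

Lemma mcvg_sum p q (I : Type) (r : seq I) (P : pred I)
    (M : I -> T -> 'M[R]_(p, q)) M0 :
  (forall i, P i -> mcvg (M i) (M0 i)) ->
  mcvg (fun t => \sum_(i <- r | P i) M i t) (\sum_(i <- r | P i) M0 i).
Proof.
move=> cM i j; rewrite summxE; under eq_cvg do rewrite summxE.
by apply: cvg_sumr => k Pk; exact: cM.
Qed.

Lemma mcvg_det p (M : T -> 'M[R]_p) M0 :
  mcvg M M0 -> \det (M t) @[t --> G] --> \det M0.
Proof.
move=> cM; apply: cvg_sumr => s _; apply: cvgM; first exact: cvg_cst.
by apply: cvg_prodr => i _; exact: cM.
Qed.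

Lemma mcvg_adj p (M : T -> 'M[R]_p) M0 :
  mcvg M M0 -> mcvg (fun t => \adj (M t)) (\adj M0).
Proof.
move=> cM i j; rewrite mxE; under eq_cvg do rewrite mxE.
apply: cvgM; first exact: cvg_cst.
apply: mcvg_det => a b; rewrite !mxE; under eq_cvg do rewrite !mxE.
exact: cM.
Qed.

Lemma mcvg_unit p (M : T -> 'M[R]_p) M0 :
  mcvg M M0 -> M0 \in unitmx -> \forall t \near G, M t \in unitmx.
Proof.
move=> cM; rewrite unitmxE unitfE => /(cvgr_neq0 _ (mcvg_det cM)).
by apply: filterS => t; rewrite unitmxE unitfE.
Qed.

(** Near an invertible limit the inverse is the adjugate over the determinant,
    hence converges; elsewhere [invmx] takes a junk value. *)
Lemma mcvg_inv p (M : T -> 'M[R]_p) M0 :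
  mcvg M M0 -> M0 \in unitmx -> mcvg (fun t => invmx (M t)) (invmx M0).
Proof.
move=> cM uM0 i j.
have cZ : mcvg (fun t => (\det (M t))^-1 *: \adj (M t)) (invmx M0).
  rewrite /invmx uM0; apply: mcvgZ; last exact: mcvg_adj.
  apply: cvgV; last exact: mcvg_det.
  by rewrite -unitfE -unitmxE.
apply: cvg_trans (cZ i j); apply: near_eq_cvg.
by near=> t; rewrite /invmx (_ : M t \in unitmx = true) //; near: t;
  exact: mcvg_unit.
Unshelve. all: by end_near. Qed.

Lemma mcvg_frob p q (M N : T -> 'M[R]_(p, q)) M0 N0 :
  mcvg M M0 -> mcvg N N0 -> frob (M t) (N t) @[t --> G] --> frob M0 N0.
Proof.
move=> cM cN; rewrite frobE; under eq_cvg do rewrite frobE.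
apply: cvg_sumr => i _; apply: cvg_sumr => j _.
by apply: cvgM; [exact: cM|exact: cN].
Qed.

Lemma mcvg_fnorm p q (M : T -> 'M[R]_(p, q)) M0 :
  mcvg M M0 -> fnorm (M t) @[t --> G] --> fnorm M0.
Proof.
move=> cM; have := mcvg_frob cM cM.
by apply: (@continuous_cvg _ _ _ _ _ _ Num.sqrt); exact: sqrt_continuous.
Qed.

(** Let L Q be the full-rank factorization of the limit, Q' a right inverse of Q
    and L' a left inverse of L.  The r combinations [D t *m Q'] of columns tend to
    L, so they have full rank near the limit; since the rank of [D t] does not
    jump, a row that annihilates them annihilates [D t].  Such a row is obtained
    from [u] by a correction in the row space of L', which tends to 0 because
    [u] annihilates the limit. *)
Lemma kernel_lift N m (D : T -> 'M[R]_(N, m)) (D0 : 'M[R]_(N, m))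
    (u : 'rV[R]_N) :
  mcvg D D0 -> (\forall t \near G, \rank (D t) = \rank D0) -> u *m D0 = 0 ->
  exists2 v : T -> 'rV[R]_N, mcvg v u & \forall t \near G, v t *m D t = 0.
Proof.
move=> cD rkD uD0.
have [L' L'L] := row_fullP (col_base_full D0).
have [Q' QQ'] := row_freeP (row_base_free D0).
have D0Q : D0 *m Q' = col_base D0 by rewrite -[X in X *m Q'](mulmx_base D0) -mulmxA QQ' mulmx1.
pose E t := L' *m (D t *m Q').
have cDQ : mcvg (fun t => D t *m Q') (D0 *m Q').
  by apply: mcvgM => //; exact: mcvg_cst.
have cE : mcvg E 1%:M.
  by rewrite -L'L -D0Q; apply: mcvgM => //; exact: mcvg_cst.
pose v t := u - u *m (D t *m Q') *m invmx (E t) *m L'.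
exists v.
  have -> : u = u - u *m (D0 *m Q') *m invmx 1%:M *m L'.
    by rewrite mulmxA uD0 !mul0mx subr0.
  apply: mcvgB; first exact: mcvg_cst.
  apply: mcvgM; last exact: mcvg_cst.
  apply: mcvgM; last by apply: mcvg_inv => //; exact: unitmx1.
  by apply: mcvgM => //; exact: mcvg_cst.
near=> t.
have uE : E t \in unitmx by near: t; apply: mcvg_unit => //; exact: unitmx1.
have rkt : \rank (D t) = \rank D0 by near: t.
have vDQ : v t *m (D t *m Q') = 0.
  rewrite /v mulmxBl -[_ *m L' *m _]mulmxA -/(E t) -[_ *m _ *m E t]mulmxA.
  by rewrite mulVmx // mulmx1 subrr.
(* D t and D t *m Q' have the same rank, hence the same left kernel *)
have rkDQ : \rank (D t *m Q') = \rank D0.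
  apply/eqP; rewrite eqn_leq rank_leq_col /=.
  have := mxrankM_maxr L' (D t *m Q').
  by rewrite -/(E t) mxrank_unit.
have kerE : (kermx (D t *m Q') <= kermx (D t))%MS.
  have sub : (kermx (D t) <= kermx (D t *m Q'))%MS.
    by apply/sub_kermxP; rewrite mulmxA mulmx_ker mul0mx.
  by rewrite -(mxrank_leqif_sup sub).2 !mxrank_ker rkDQ rkt.
by apply/sub_kermxP; apply: submx_trans kerE; apply/sub_kermxP.
Unshelve. all: by end_near. Qed.

End EntrywiseLimits.

Arguments mcvg_cst {R T G FG p q} M0 i j.

(** * The least eigenvalue bounds the Rayleigh quotient *)

Section Rayleigh.
Context {R : realType}.

(** A linear term cannot be dominated by a quadratic one near 0. *)
Lemma linear_coef_eq0 (a b : R) : (forall t, 0 <= t * a + t ^+ 2 * b) -> a = 0.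
Proof.
move=> h; pose s := (1 + `|b|)^-1.
have s0 : 0 < 1 + `|b| by rewrite ltr_pwDl.
have := h (- a * s).
have -> : - a * s * a + (- a * s) ^+ 2 * b = - (a ^+ 2 * s * (1 - s * b)) by ring.
rewrite oppr_ge0 => le0.
have sb : s * b < 1.
  rewrite mulrC ltr_pdivrMr // mul1r (le_lt_trans (ler_norm _)) //.
  by rewrite ltrDr.
have pos : 0 < s * (1 - s * b) by rewrite mulr_gt0 ?invr_gt0 // subr_gt0.
have : a ^+ 2 <= 0.
  by rewrite -(pmulr_lle0 _ pos) mulrA.
by rewrite real_exprn_even_le0 ?num_real //= => /eqP.
Qed.

Lemma continuous_form N (H : 'M[R]_N) : continuous (fun x : 'rV[R]_N => frob (x *m H) x).
Proof.
move=> x; have cx : mcvg (nbhs x) (fun y : 'rV[R]_N => y) x.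
  by move=> i j; exact: (@coord_continuous R 1 N i j x).
exact: (mcvg_frob (mcvgM cx (mcvg_cst H)) cx).
Qed.

(** The minimum of the quadratic form on the unit sphere is attained, and the
    first-order condition makes the minimizer an eigenvector. *)
Lemma rayleigh N (H : 'M[R]_N.+1) : H^T = H ->
  exists2 a, eigenvalue H a & forall x : 'rV_N.+1, a * frob x x <= frob (x *m H) x.
Proof.
move=> Hs; pose S := [set x : 'rV[R]_N.+1 | frob x x = 1].
have cS : compact S.
  apply: bounded_closed_compact.
    exists 1; split; first exact: num_real.
    move=> M M1 x Sx /=; apply: le_trans (ltW M1).
    rewrite [leLHS]/Num.norm /= mx_normrE.
    apply: bigmax_le => // -[i j] _ /=; apply: le_trans (entry_le_fnorm _ _ _) _.
    by rewrite /fnorm Sx sqrtr1.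
  apply: (@closed_comp _ _ (fun x : 'rV[R]_N.+1 => frob x x) [set 1]) => //.
    move=> x _; have := @continuous_form _ 1%:M x.
    by under eq_fun do rewrite mulmx1.
have S0 : S !=set0.
  exists (delta_mx 0 0); rewrite /S /= frobE big_ord1 (bigD1 0) //= big1.
    by rewrite !mxE /= mulr1 addr0.
  by move=> j /negPf j0; rewrite !mxE /= j0 mulr0.
have [x0 Sx0 xmin] := EVT_min_rV S0 cS
  (continuous_subspaceT (@continuous_form _ H)).
set a := frob (x0 *m H) x0 in xmin.
have ge (x : 'rV_N.+1) : a * frob x x <= frob (x *m H) x.
  have [/frob_eq0->|x0N] := eqVneq (frob x x) 0.
    by rewrite !frob0r mulr0.
  have xp : 0 < frob x x by rewrite lt_def x0N frob_ge0.
  have np : 0 < fnorm x by rewrite sqrtr_gt0.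
  have Sx : (fnorm x)^-1 *: x \in S.
    rewrite inE /S /= frobZl frobZr mulrA -invfM -expr2 fnorm_sqr mulVf //.
  have := xmin _ Sx; rewrite -scalemxAl frobZl frobZr mulrA -invfM -expr2.
  by rewrite fnorm_sqr mulrC ler_pdivlMr.
exists a => //; apply/eigenvalueP; exists x0; last first.
  apply/eqP => x00; have := Sx0; rewrite inE /S /= x00 => /esym.
  by rewrite frob0r => /eqP; rewrite oner_eq0.
apply/eqP; rewrite -subr_eq0; apply/eqP/frob_eq0.
set z := x0 *m H - a *: x0; set w := frob z z.
suff : 2 * w = 0 by move/eqP; rewrite mulf_eq0 pnatr_eq0 /= => /eqP.
apply: (@linear_coef_eq0 _ (frob (z *m H) z - a * frob z z)) => t.
have := ge (x0 + t *: z); rewrite -subr_ge0.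
congr (0 <= _).
have x01 : frob x0 x0 = 1 by move: Sx0; rewrite inE.
have zw : w = frob (x0 *m H) z - a * frob x0 z by rewrite -frobZl -frobBl.
rewrite zw; clearbody z; rewrite mulmxDl -scalemxAl !(frobDl, frobDr, frobZl, frobZr) -/a x01.
rewrite (frob_mulmxr z x0 Hs) (frobC z (x0 *m H)) (frobC z x0); ring.
Qed.

(** The eigenvalue of the previous lemma is the least one: any other is the
    value of the Rayleigh quotient at one of its eigenvectors. *)
Lemma lambda_min_le N (H : 'M[R]_N) (x : 'rV[R]_N) : H^T = H ->
  lambda_min H * frob x x <= frob (x *m H) x.
Proof.
case: N => [|N] in H x * => Hs.
  by rewrite !frobE !big_ord1 !big_ord0 mulr0.
have [a ea age] := rayleigh Hs.
apply: le_trans (age x); rewrite ler_wpM2r ?frob_ge0 //.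
apply: ge_inf => //; exists a => c /= /eigenvalueP[v vH v0].
have : 0 < frob v v.
  by rewrite lt_def frob_ge0 andbT; apply: contra_neq v0; exact: frob_eq0.
by move=> vp; have := age v; rewrite vH frobZl ler_pM2r.
Qed.

End Rayleigh.

(** * Quadratic objectives under quadratic constraints *)

Section SymmetricBilinear.
Context {R : realType} {N : nat}.
Implicit Types u v w : 'rV[R]_N.

Definition bisym (W : lmodType R) (B : 'rV[R]_N -> 'rV[R]_N -> W) : Prop :=
  (forall u v, B u v = B v u) /\
  (forall a u v w, B (a *: u + v) w = a *: B u w + B v w).

Section Theory.
Variables (W : lmodType R) (B : 'rV[R]_N -> 'rV[R]_N -> W).
Hypothesis BB : bisym B.

Lemma bisymC u v : B u v = B v u. Proof. exact: BB.1. Qed.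

Lemma bisymPl a u v w : B (a *: u + v) w = a *: B u w + B v w.
Proof. exact: BB.2. Qed.

Lemma bisymPr a u v w : B w (a *: u + v) = a *: B w u + B w v.
Proof. by rewrite !(bisymC w) bisymPl. Qed.

Lemma bisym0r u : B u 0 = 0.
Proof.
have := bisymPr (-1) 0 0 u; rewrite scaler0 addr0 scaleN1r => h.
by rewrite {1}h addNr.
Qed.

Lemma bisym_sumr u v : B u v = \sum_j v 0 j *: B u (delta_mx 0 j).
Proof.
rewrite {1}[v]row_sum_delta (big_morph (B u) (id1 := 0) (op1 := +%R)).
- by apply: eq_bigr => j _; rewrite -[_ *: delta_mx _ _]addr0 bisymPr bisym0r addr0.
- by move=> a c; rewrite -{1}[a]scale1r bisymPr scale1r.
- exact: bisym0r.
Qed.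

Lemma bisym_sum u v :
  B u v = \sum_i \sum_j (u 0 i * v 0 j) *: B (delta_mx 0 i) (delta_mx 0 j).
Proof.
rewrite bisymC bisym_sumr; apply: eq_bigr => i _.
rewrite bisymC bisym_sumr scaler_sumr; apply: eq_bigr => j _.
by rewrite scalerA.
Qed.

Lemma bisym_line h v x :
  B (h *: v + x) (h *: v + x) = B x x + (2 * h) *: B x v + h ^+ 2 *: B v v.
Proof.
rewrite bisymPl !bisymPr (bisymC v x) scalerDr scalerA -expr2.
rewrite mulr_natl mulr2n scalerDl [RHS]addrC [B x x + _]addrC.
by rewrite -!addrA.
Qed.

End Theory.

(* The same facts for forms with values in the field itself, stated with the
   operations of the ring rather than those of the regular module. *)
Section Scalar.
Variable B : 'rV[R]_N -> 'rV[R]_N -> R.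
Hypothesis BB : @bisym R^o B.

Lemma formPl a u v w : B (a *: u + v) w = a * B u w + B v w.
Proof. exact: (bisymPl BB). Qed.

Lemma form_sumr u v : B u v = \sum_j v 0 j * B u (delta_mx 0 j).
Proof. exact: (bisym_sumr BB). Qed.

Lemma form_sum u v :
  B u v = \sum_i \sum_j u 0 i * v 0 j * B (delta_mx 0 i) (delta_mx 0 j).
Proof. exact: (bisym_sum BB). Qed.

Lemma form_line h v x :
  B (h *: v + x) (h *: v + x) = B x x + 2 * h * B x v + h ^+ 2 * B v v.
Proof. exact: (bisym_line BB). Qed.

End Scalar.

End SymmetricBilinear.

Section BilinearLimits.
Context {R : realType} {N : nat} {T : Type} (G : set_system T) {FG : Filter G}.
Variables (u v : T -> 'rV[R]_N) (u0 v0 : 'rV[R]_N).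
Hypotheses (cu : mcvg G u u0) (cv : mcvg G v v0).

Lemma bisym_mcvg m (B : 'rV[R]_N -> 'rV[R]_N -> 'rV[R]_m) :
  bisym B -> mcvg G (fun t => B (u t) (v t)) (B u0 v0).
Proof.
move=> BB; rewrite bisym_sum //.
under [X in mcvg _ X _]eq_fun do rewrite bisym_sum //.
apply: mcvg_sum => i _; apply: mcvg_sum => j _.
apply: mcvgZ; last exact: mcvg_cst.
by apply: cvgM; [exact: cu|exact: cv].
Qed.

Lemma bisym_cvg (B : 'rV[R]_N -> 'rV[R]_N -> R) :
  @bisym R N R^o B -> B (u t) (v t) @[t --> G] --> B u0 v0.
Proof.
move=> BB; rewrite (form_sum BB); under eq_cvg do rewrite (form_sum BB).
apply: cvg_sumr => i _; apply: cvg_sumr => j _.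
by apply: cvgM; [apply: cvgM; [exact: cu|exact: cv]|exact: cvg_cst].
Qed.

End BilinearLimits.

Section QuadraticProgram.
Context {R : realType} {N m : nat}.
Variables (K : 'rV[R]_N -> 'rV[R]_N -> R).
Variables (D : 'rV[R]_N -> 'rV[R]_N -> 'rV[R]_m) (b : 'rV[R]_m).
Hypotheses (KK : @bisym R N R^o K) (DD : bisym D).
Implicit Types (x u v : 'rV[R]_N) (y nu : 'rV[R]_m) (rho : R).

Definition qconstr x : 'rV[R]_m := 2^-1 *: D x x - b.

(** The Hessian of the Lagrangian with multiplier [y], as a bilinear form; its
    gradient at [x] is [qlag y x]. *)
Definition qlag y u v : R := K u v - frob y (D u v).

Definition qaug rho y x : R :=
  2^-1 * K x x - frob y (qconstr x) + rho / 2 * fnorm (qconstr x) ^+ 2.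

Lemma qlag_bisym y : @bisym R N R^o (qlag y).
Proof.
split=> [u v|a u v w]; first by rewrite /qlag (bisymC KK) (bisymC DD).
rewrite /qlag (formPl KK) (bisymPl DD) frobDr frobZr /GRing.scale /=; ring.
Qed.

Lemma derive_line (f : 'rV[R]_N -> R) x v (a r0 r1 r2 : R) :
  (forall h, f (h *: v + x) = f x + h * a + h ^+ 2 * (r0 + r1 * h + r2 * h ^+ 2)) ->
  'D_v f x = a.
Proof.
move=> fE; rewrite /derive; apply/cvg_lim => //.
have ca : (a + h * (r0 + r1 * h + r2 * h ^+ 2)) @[h --> (0 : R)^'] --> a.
  rewrite -[X in _ --> X](_ : a + 0 * (r0 + r1 * 0 + r2 * 0 ^+ 2) = a); last by ring.
  apply: (@cvg_within_filter _ _ _ (nbhs (0 : R))).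
  apply: cvgD; first exact: cvg_cst.
  apply: cvgM; first exact: cvg_id.
  apply: cvgD; first (apply: cvgD; [exact: cvg_cst|]).
    by apply: cvgM; [exact: cvg_cst|exact: cvg_id].
  apply: cvgM; first exact: cvg_cst.
  by rewrite expr2; under eq_fun do rewrite expr2; apply: cvgM; exact: cvg_id.
apply: cvg_trans ca; apply: near_eq_cvg; near=> h.
have h0 : h != 0 by near: h; exact: nbhs_dnbhs_neq.
rewrite /= fE /GRing.scale /=; field; exact: h0.
Unshelve. all: by end_near. Qed.

Lemma qconstr_line h v x :
  qconstr (h *: v + x) = qconstr x + h *: D x v + (h ^+ 2 / 2) *: D v v.
Proof.
rewrite /qconstr bisym_line // !scalerDr !scalerA mulrA mulVf ?pnatr_eq0 // mul1r.
by rewrite [2^-1 * _]mulrC -!addrA; congr (_ + _); rewrite [RHS]addrC !addrA.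
Qed.

(** The penalty shifts the multiplier to [y - rho *: qconstr x], the multiplier
    that the method uses next. *)
Lemma qaug_derive rho y x v :
  'D_v (qaug rho y) x = qlag (y - rho *: qconstr x) x v.
Proof.
pose s := qconstr x; pose d := D x v; pose e := D v v.
apply: (@derive_line _ _ _ _ (2^-1 * K v v - frob y e / 2 +
    rho / 2 * (frob d d + frob s e)) (rho / 2 * frob d e) (rho / 8 * frob e e)).
move=> h; rewrite /qaug /qlag qconstr_line (form_line KK) !fnorm_sqr -/s -/d -/e.
clearbody s d e.
rewrite !(frobDl, frobNl, frobZl, frobDr, frobZr) (frobC d s) (frobC e s) (frobC e d).
by field; rewrite ?pnatr_eq0.
Qed.

Lemma qaug_derive2 rho y x u v :
  'D_u ('D_v (qaug rho y)) x =
  qlag (y - rho *: qconstr x) u v + rho * frob (D x u) (D x v).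
Proof.
have -> : 'D_v (qaug rho y) = fun z => qlag (y - rho *: qconstr z) z v.
  by apply/funext => z; exact: qaug_derive.
pose s := qconstr x; pose e := D u u; pose d := D x u.
apply: (@derive_line _ _ _ _ (rho * (frob d (D u v) + frob e (D x v) / 2))
   (rho / 2 * frob e (D u v)) 0).
move=> h; rewrite /qlag qconstr_line (formPl KK) (bisymPl DD) -/s -/d -/e.
clearbody s d e.
rewrite !(frobDl, frobNl, frobZl, frobDr, frobZr); by field; rewrite ?pnatr_eq0.
Qed.

Lemma gradient_qaug rho y x v :
  frob (gradient (qaug rho y) x) v = qlag (y - rho *: qconstr x) x v.
Proof.
rewrite (form_sumr (qlag_bisym _)) frobE big_ord1; apply: eq_bigr => j _.
by rewrite mxE qaug_derive mulrC.
Qed.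

Lemma hessian_qaugE rho y x i j :
  hessian (qaug rho y) x i j =
  qlag (y - rho *: qconstr x) (delta_mx 0 i) (delta_mx 0 j) +
  rho * frob (D x (delta_mx 0 i)) (D x (delta_mx 0 j)).
Proof. by rewrite -qaug_derive2; exact: mxE. Qed.

Lemma hessian_qaug_sym rho y x :
  (hessian (qaug rho y) x)^T = hessian (qaug rho y) x.
Proof.
apply/matrixP => i j; rewrite mxE hessian_qaugE [RHS]hessian_qaugE.
by rewrite [X in _ = _ + _ * X]frobC; congr (_ + _); exact: (qlag_bisym _).1.
Qed.

Lemma hessian_qaug rho y x v :
  frob (v *m hessian (qaug rho y) x) v =
  qlag (y - rho *: qconstr x) v v + rho * frob (D x v) (D x v).
Proof.
pose B u w := qlag (y - rho *: qconstr x) u w + rho * frob (D x u) (D x w).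
have BB : @bisym R N R^o B.
  have [sL lL] := qlag_bisym (y - rho *: qconstr x).
  split=> [u w|a u w z]; first by rewrite /B sL frobC.
  rewrite /B lL (bisymPr DD) frobDl frobZl /GRing.scale /=; ring.
rewrite -/(B v v) (form_sum BB) frobE big_ord1 exchange_big /=.
apply: eq_bigr => j _; rewrite mxE mulr_suml; apply: eq_bigr => i _.
by rewrite hessian_qaugE -/(B _ _); ring.
Qed.

Lemma mul_lin1_bisym x u : u *m lin1_mx (D x) = D x u.
Proof.
rewrite (bisym_sumr DD) mulmx_sum_row; apply: eq_bigr => i _; congr (_ *: _).
by apply/rowP => j; rewrite !mxE.
Qed.

(** Since the rank does not change near [x], the kernel direction [u] is the limit
    of vectors [v t] in the kernels at [x + t u].  Pairing
    [D (x + t u) (v t) = 0] with a covector [nu] that vanishes on the range at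
    [x] leaves [t * frob nu (D u (v t)) = 0]; divide by [t] and let it tend to 0. *)
Lemma constant_rank_curvature (O : set 'rV[R]_N) r x u nu :
  open O -> O x -> (forall z, O z -> \rank (lin1_mx (D z)) = r) ->
  D x u = 0 -> (forall v, frob nu (D x v) = 0) -> frob nu (D u u) = 0.
Proof.
move=> oO Ox rkO Dxu nux.
pose z (t : R) := t *: u + x.
have cz : z t @[t --> (0 : R)^'] --> x.
  apply: (@cvg_within_filter _ _ _ (nbhs (0 : R))).
  have z0 : z 0 = x by rewrite /z scale0r add0r.
  rewrite -z0; apply: cvgD; last exact: cvg_cst.
  by apply: cvgZr_tmp; exact: cvg_id.
have cze : mcvg (0 : R)^' z x.
  exact: cvg_mcvg.
have cD : mcvg (0 : R)^' (fun t => lin1_mx (D (z t))) (lin1_mx (D x)).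
  move=> i j; rewrite mxE; under eq_cvg do rewrite mxE.
  by apply: bisym_mcvg => //; exact: mcvg_cst.
have rkD : \forall t \near (0 : R)^', \rank (lin1_mx (D (z t))) = \rank (lin1_mx (D x)).
  have : \forall t \near (0 : R)^', O (z t) by apply: cz; exact: open_nbhs_nbhs.
  by apply: filterS => t Ozt; rewrite !rkO.
have [v cv vD] : exists2 v : R -> 'rV[R]_N, mcvg (0 : R)^' v u &
    \forall t \near (0 : R)^', v t *m lin1_mx (D (z t)) = 0.
  by apply: kernel_lift => //; rewrite mul_lin1_bisym.
have lim0 : frob nu (D u (v t)) @[t --> (0 : R)^'] --> frob nu (D u u).
  apply: mcvg_frob; first exact: mcvg_cst.
  by apply: bisym_mcvg => //; exact: mcvg_cst.
suff c0 : frob nu (D u (v t)) @[t --> (0 : R)^'] --> (0 : R).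
  exact: (cvg_unique _ lim0 c0).
apply: cvg_near_cst; near=> t.
have t0 : t != 0 by near: t; exact: nbhs_dnbhs_neq.
have : D (z t) (v t) = 0 by rewrite -mul_lin1_bisym; near: t.
rewrite (bisymPl DD) => /(congr1 (frob nu)).
rewrite frobDr frobZr nux addr0 frob0r => /eqP.
by rewrite mulf_eq0 (negPf t0) /= => /eqP.
Unshelve. all: by end_near. Qed.

(** The conditions that an inexact inner solve enforces pass to the limit.
    First-order residuals vanish by continuity.  For the curvature along a
    kernel direction [u] at the limit, the test directions are lifted into the
    kernels of the Jacobians of the iterates, where the penalty term, whose
    weight may be unbounded, contributes nothing. *)
Lemma qaug_limit (T : Type) (G : set_system T) {FG : ProperFilter G}
    (x : T -> 'rV[R]_N) (y ynext : T -> 'rV[R]_m) (rho omega zeta : T -> R)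
    (x0 : 'rV[R]_N) (y0 : 'rV[R]_m) :
  mcvg G x x0 -> mcvg G ynext y0 ->
  (forall t, ynext t = y t - rho t *: qconstr (x t)) ->
  (forall t, fnorm (gradient (qaug (rho t) (y t)) (x t)) <= omega t) ->
  (forall t, - zeta t <= lambda_min (hessian (qaug (rho t) (y t)) (x t))) ->
  omega @ G --> (0 : R) -> zeta @ G --> (0 : R) ->
  (\forall t \near G, \rank (lin1_mx (D (x t))) = \rank (lin1_mx (D x0))) ->
  (forall v, qlag y0 x0 v = 0) /\ (forall u, D x0 u = 0 -> 0 <= qlag y0 u u).
Proof.
move=> cx cy yE grad hess comega czeta rk.
have clag (u v : T -> 'rV[R]_N) (u0 v0 : 'rV[R]_N) : mcvg G u u0 -> mcvg G v v0 ->
    qlag (ynext t) (u t) (v t) @[t --> G] --> qlag y0 u0 v0.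
  move=> cu cv; apply: cvgB; first exact: bisym_cvg.
  by apply: mcvg_frob => //; exact: bisym_mcvg.
split=> [v|u Du].
  rewrite (form_sumr (qlag_bisym _)) big1 // => j _.
  have -> : qlag y0 x0 (delta_mx 0 j) = 0; last by rewrite mulr0.
  have c1 : qlag (ynext t) (x t) (delta_mx 0 j) @[t --> G] -->
      qlag y0 x0 (delta_mx 0 j) by apply: clag => //; exact: mcvg_cst.
  suff c0 : qlag (ynext t) (x t) (delta_mx 0 j) @[t --> G] --> (0 : R).
    exact: (cvg_unique _ c1 c0).
  apply: norm_cvg0.
  apply: (@squeeze_cvgr _ _ _ _ (fun=> 0) omega); [|exact: cvg_cst|exact: comega].
  near=> t; rewrite normr_ge0 /= (le_trans _ (grad t)) //.
  rewrite yE -gradient_qaug frobE big_ord1 (bigD1 j) //= big1 ?addr0.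
    by rewrite [delta_mx _ _ _ _]mxE !eqxx mulr1; exact: entry_le_fnorm.
  by move=> i /negPf ij; rewrite [delta_mx _ _ _ _]mxE ij mulr0.
have cD : mcvg G (fun t => lin1_mx (D (x t))) (lin1_mx (D x0)).
  move=> i j; rewrite mxE; under eq_cvg do rewrite mxE.
  by apply: bisym_mcvg => //; exact: mcvg_cst.
have [v cv vD] : exists2 v : T -> 'rV[R]_N, mcvg G v u &
    \forall t \near G, v t *m lin1_mx (D (x t)) = 0.
  by apply: kernel_lift => //; rewrite mul_lin1_bisym.
have c1 : (qlag (ynext t) (v t) (v t) + zeta t * frob (v t) (v t)) @[t --> G]
    --> qlag y0 u u + 0 * frob u u.
  apply: cvgD; first exact: clag.
  by apply: cvgM => //; exact: mcvg_frob.
rewrite -[leRHS]addr0 -[X in _ + X](mul0r (frob u u)).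
apply: (cvgr_to_ge c1); near=> t.
have vt : D (x t) (v t) = 0 by rewrite -mul_lin1_bisym; near: t.
have := lambda_min_le (v t) (hessian_qaug_sym (rho t) (y t) (x t)).
rewrite hessian_qaug -yE vt.
rewrite frob0r mulr0 addr0 => h; apply: le_trans (lerD h (lexx _)).
by rewrite -mulrDl mulr_ge0 ?frob_ge0 // -[zeta t]opprK subr_ge0.
Unshelve. all: by end_near. Qed.

End QuadraticProgram.

(** * Accumulation points of the augmented Lagrangian iterates *)

Section UltrafilterLimits.
Context {R : realType}.

(** An accumulation point of a sequence is its limit along an ultrafilter on
    the indices that refines the tails.  The sequence is shifted since the
    iteration at step l produces the term of index l + 1. *)
Lemma cluster_ultra (T : topologicalType) (x : nat -> T) (p : T) :
  cluster (x @ \oo) p ->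
  exists G : set_system nat, [/\ UltraFilter G, \oo `<=` G &
    x l.+1 @[l --> G] --> p].
Proof.
move=> clx; pose B : set_system nat := [set S | exists V N, nbhs p V /\
  forall l, (N <= l)%N -> V (x l.+1) -> S l].
have FB : ProperFilter B.
  split.
    move=> [V [N [pV VN]]].
    have [|_ [[l /= lN <-] Vl]] := clx [set x l | l in [set l | (N < l)%N]] V _ pV.
      by exists N.+1 => // l /= lN; exists l.
    by case: l lN Vl => // l lN Vl; exact: VN lN Vl.
  split; first by exists setT, 0%N; split => //; exact: filterT.
    move=> S S' [V [N [pV VS]]] [V' [N' [pV' VS']]].
    exists (V `&` V'), (maxn N N'); split; first exact: filterI.
    by move=> l; rewrite geq_max => /andP[Nl N'l] [Vx V'x]; split;
      [exact: VS|exact: VS'].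
  move=> S S' SS' [V [N [pV VS]]]; exists V, N; split => // l Nl Vx.
  by apply: SS'; exact: VS.
have [G [UG BG]] := ultraFilterLemma FB.
exists G; split => //.
  move=> S [N _ NS]; apply: BG; exists setT, N; split; first exact: filterT.
  by move=> l Nl _; exact: NS.
by move=> V pV; apply: BG; exists V, 0%N.
Qed.

(** Boundedness is all that convergence along an ultrafilter needs; no
    subsequence has to be extracted. *)
Lemma ultra_bounded_cvg (T : Type) (G : set_system T) (f : T -> R) (M : R) :
  UltraFilter G -> (forall t, `|f t| <= M) -> exists l : R, f t @[t --> G] --> l.
Proof.
move=> UG fM; have GG : ProperFilter G by exact: ultra_proper.
have GM : (f @ G) `[- M, M]%classic.
  by apply: (@filterS _ G _ setT) => [t _|]; [rewrite /= in_itv /= -ler_norml|exact: filterT].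
have [l [_ cl]] := @segment_compact R (- M) M (f @ G) _ GM.
exists l => V lV; have [//|nV] := in_ultra_setVsetC (f @^-1` V) UG.
by have [z []] := cl (~` V) V nV lV.
Qed.

Lemma ultra_bounded_mcvg (T : Type) (G : set_system T) p q
    (f : T -> 'M[R]_(p, q)) (M : R) :
  UltraFilter G -> (forall t, fnorm (f t) <= M) -> exists l, mcvg G f l.
Proof.
move=> UG fM.
have ex i j : exists l : R, f t i j @[t --> G] --> l.
  by apply: (@ultra_bounded_cvg _ _ _ M) => // t;
    apply: le_trans (entry_le_fnorm _ _ _) _.
exists (\matrix_(i, j) projT1 (cid (ex i j))) => i j.
by rewrite mxE; case: cid.
Qed.

End UltrafilterLimits.

Section Penalty.
Context {R : realType}.

(** Either the sufficient decrease test succeeds from some step on, and the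
    infeasibilities decay geometrically, or the penalty is increased infinitely
    often and tends to infinity, and the bound on [rho l * a l.+1] forces the
    infeasibilities to 0. *)
Lemma penalty_feasible (theta gamma M : R) (a rho : nat -> R) :
  0 < theta < 1 -> 1 < gamma -> 0 < rho 0%N -> (forall l, 0 <= a l) ->
  (forall l, rho l * a l.+1 <= M) ->
  (forall l, rho l.+1 = if a l.+1 <= theta * a l then rho l else gamma * rho l) ->
  a @ \oo --> (0 : R).
Proof.
move=> /andP[th0 th1] g1 r0 a0 aM rule.
have g0 : 0 < gamma by rewrite (lt_trans _ g1).
have rpos l : 0 < rho l.
  by elim: l => // l IH; rewrite rule; case: ifP => // _; rewrite mulr_gt0.
have rmono l l' : (l <= l')%N -> rho l <= rho l'.
  move=> /subnK<-; elim: (l' - l)%N => // d IH; rewrite addSn rule.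
  by case: ifP => // _; apply: le_trans IH _; rewrite ler_peMl // ltW.
have [[l0 dec]|inc] := pselect (exists l0, forall l, (l0 <= l)%N ->
    a l.+1 <= theta * a l).
  have geo l : a (l + l0)%N <= geometric (a l0) theta l.
    elim: l => [|l IH] /=; first by rewrite add0n expr0 mulr1.
    rewrite addSn; apply: le_trans (dec _ (leq_addl _ _)) _.
    by rewrite exprS mulrCA ler_pM2l.
  rewrite -(cvg_shiftn l0).
  apply: (@squeeze_cvgr _ _ _ _ (fun=> 0) (geometric (a l0) theta)).
  - by near=> l; rewrite a0 /=; exact: geo.
  - exact: cvg_cst.
  - by apply: cvg_geometric; rewrite gtr0_norm.
have incr l : exists2 l', (l <= l')%N & rho l'.+1 = gamma * rho l'.
  apply: contrapT => nex; apply: inc; exists l => l' ll'.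
  apply: contrapT => ndec; apply: nex; exists l' => //.
  by rewrite rule; case: ifP => // /ndec.
have large k : exists l, gamma ^+ k * rho 0%N <= rho l.
  elim: k => [|k [l IH]]; first by exists 0%N; rewrite expr0 mul1r.
  have [l' ll' rl'] := incr l; exists l'.+1.
  by rewrite rl' exprS -mulrA ler_pM2l // (le_trans IH) // rmono.
have M0 : 0 <= M by apply: le_trans (aM 0%N); rewrite mulr_ge0 // ltW.
apply/cvgrPdist_lt => e e0.
have cg : geometric (M / rho 0%N) gamma^-1 @ \oo --> (0 : R).
  by apply: cvg_geometric; rewrite gtr0_norm ?invr_gt0 // invf_lt1.
have /cvgrPdist_lt/(_ _ e0)[k _ /(_ k (leqnn _))/=] := cg.
rewrite sub0r normrN => ke; have [l0 Hl0] := large k.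
have bnd l : (l0 < l)%N -> a l < e.
  case: l => // l l0l; apply: le_lt_trans ke; apply: le_trans (ler_norm _).
  rewrite exprVn ler_pdivlMr ?exprn_gt0 // ler_pdivlMr // -mulrA.
  apply: le_trans (aM l); rewrite mulrC ler_wpM2r // (le_trans Hl0) // rmono //.
by near=> l; rewrite sub0r normrN ger0_norm // bnd //; near: l; exact: nbhs_infty_gt.
Unshelve. all: by end_near. Qed.

End Penalty.

Section AugmentedLagrangianLimit.
Context {R : realType} {N m : nat}.
Variables (K : 'rV[R]_N -> 'rV[R]_N -> R).
Variables (D : 'rV[R]_N -> 'rV[R]_N -> 'rV[R]_m) (b : 'rV[R]_m).
Hypotheses (KK : @bisym R N R^o K) (DD : bisym D).
Variables (theta gamma M : R) (omega zeta : nat -> R).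
Variables (x : nat -> 'rV[R]_N) (y : nat -> 'rV[R]_m) (rho : nat -> R).

Local Notation Phi l := (qaug K D b (rho l) (y l)).
Local Notation cx l := (qconstr D b (x l)).

Hypotheses (theta01 : 0 < theta < 1) (gamma1 : 1 < gamma).
Hypothesis yE : forall l, y l.+1 = y l - rho l *: cx l.+1.
Hypothesis grad : forall l, fnorm (gradient (Phi l) (x l.+1)) <= omega l.
Hypothesis hess : forall l, - zeta l <= lambda_min (hessian (Phi l) (x l.+1)).
Hypotheses (comega : omega @ \oo --> (0 : R)) (czeta : zeta @ \oo --> (0 : R)).
Hypotheses (rho0 : 0 < rho 0%N) (yM : forall l, fnorm (y l) <= M).
Hypothesis rule : forall l, rho l.+1 =
  if fnorm (cx l.+1) <= theta * fnorm (cx l) then rho l else gamma * rho l.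

(** The product of penalty and infeasibility is the norm of a difference of
    consecutive multipliers, hence bounded. *)
Lemma alm_infeasibility : fnorm (cx l) @[l --> \oo] --> (0 : R).
Proof.
apply: (@penalty_feasible _ theta gamma (2 * M) _ rho) => // [l|l].
  exact: fnorm_ge0.
have rpos : 0 <= rho l.
  elim: l => [|l IH]; first exact: ltW.
  by rewrite rule; case: ifP => // _; rewrite mulr_ge0 // ltW // (lt_trans _ gamma1).
have M0 : 0 <= M by apply: le_trans (yM 0%N); exact: fnorm_ge0.
rewrite -(@ler_pXn2r _ 2) ?nnegrE ?mulr_ge0 ?fnorm_ge0 //.
rewrite exprMn fnorm_sqr expr2 -mulrA -frobZr -frobZl.
have -> : rho l *: cx l.+1 = y l - y l.+1 by rewrite yE opprB addrC subrK.
have yM2 j : frob (y j) (y j) <= M ^+ 2.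
  by rewrite -fnorm_sqr ler_pXn2r ?nnegrE ?fnorm_ge0.
(* the square of the difference is at most twice the sum of the squares, since
   the square of the sum is nonnegative *)
have := frob_ge0 (y l + y l.+1); have := yM2 l; have := yM2 l.+1.
rewrite !(frobDl, frobNl, frobBr, frobDr) (frobC (y l.+1) (y l)) exprMn; lra.
Qed.

(** The limit of the multipliers along the ultrafilter is stationary and gives
    nonnegative curvature; the curvature along kernel directions is the same
    for all stationary multipliers. *)
Lemma alm_limit_point (O : set 'rV[R]_N) (r : nat) (xs : 'rV[R]_N) :
  open O -> (forall z, qconstr D b z = 0 -> O z) ->
  (forall z, O z -> \rank (lin1_mx (D z)) = r) -> cluster (x @ \oo) xs ->
  qconstr D b xs = 0 /\
  exists2 ybar, (forall v, qlag K D ybar xs v = 0) &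
    forall mu u, (forall v, qlag K D mu xs v = 0) -> D xs u = 0 ->
      0 <= qlag K D mu u u.
Proof.
move=> oO feasO rkO /cluster_ultra[G [UG ooG cxs]].
have GG : ProperFilter G by exact: ultra_proper.
have mx := cvg_mcvg cxs.
have cq : mcvg G (fun l => cx l.+1) (qconstr D b xs).
  apply: mcvgB; last exact: mcvg_cst.
  by apply: mcvgZ; [exact: cvg_cst|exact: bisym_mcvg].
have feas : qconstr D b xs = 0.
  apply: frob_eq0; rewrite -fnorm_sqr.
  have c0 : fnorm (cx l.+1) @[l --> G] --> (0 : R).
    move=> V V0; apply: ooG; have := alm_infeasibility.
    by rewrite -(cvg_shiftS) => /(_ V V0).
  by rewrite (cvg_unique _ (mcvg_fnorm cq) c0) ?expr0n.
split=> //.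
have [ybar cy] : exists l, mcvg G (fun l => y l.+1) l.
  by apply: (@ultra_bounded_mcvg _ _ _ _ _ _ M) => // l; exact: yM.
have rk : \forall l \near G, \rank (lin1_mx (D (x l.+1))) = \rank (lin1_mx (D xs)).
  have : \forall l \near G, O (x l.+1).
    by apply: cxs; apply: open_nbhs_nbhs; split=> //; exact: feasO.
  by apply: filterS => l Ol; rewrite !rkO //; exact: feasO.
have [foc soc] := qaug_limit KK DD mx cy yE grad hess
  (cvg_trans (cvg_app _ ooG) comega) (cvg_trans (cvg_app _ ooG) czeta) rk.
exists ybar => // mu u muF Du.
have : frob (ybar - mu) (D u u) = 0.
  apply: (constant_rank_curvature DD oO (feasO _ feas) rkO Du) => v.
  by have := foc v; have := muF v; rewrite /qlag frobBl; lra.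
by have := soc u Du; rewrite /qlag frobBl; lra.
Qed.

End AugmentedLagrangianLimit.

(** * Second-order critical limit points of the factored problem *)

Section FactoredProblem.
Context {R : realType} {q m : nat} {n k : 'I_q -> nat}.
Variables (A : forall c, 'Hom(sym R (n c), 'rV[R]_m)) (b : 'rV[R]_m).
Implicit Types (F U V : blocks R n k) (y : 'rV[R]_m).

Lemma blk_inj p r (X Y : blocks R p r) :
  (forall c : 'I_q, blk c X = blk c Y) -> X = Y.
Proof.
move=> XY; rewrite -[X]blkK -[Y]blkK; congr pack.
by apply: functional_extensionality_dep => c; exact: XY.
Qed.

Lemma blk_lin p r (c : 'I_q) a (X Y : blocks R p r) :
  blk c (a *: X + Y) = a *: blk c X + blk c Y.
Proof. exact: linearP. Qed.

Lemma blkZ p r (c : 'I_q) a (X : blocks R p r) : blk c (a *: X) = a *: blk c X.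
Proof. exact: linearZ. Qed.

Lemma dgramC n0 k0 (F U : 'M[R]_(n0, k0)) : dgram F U = dgram U F.
Proof. by apply: subvs_inj; rewrite /= addrC. Qed.

Lemma dgramPl n0 k0 a (F G U : 'M[R]_(n0, k0)) :
  dgram (a *: F + G) U = a *: dgram F U + dgram G U.
Proof.
apply: subvs_inj; rewrite [RHS]linearP /= linearP /= mulmxDl mulmxDr.
by rewrite -scalemxAl -scalemxAr scalerDr addrACA.
Qed.

Lemma dgram_diag n0 k0 (F : 'M[R]_(n0, k0)) : dgram F F = 2 *: gram F.
Proof. by apply: subvs_inj; rewrite linearZ /= scaler_nat mulr2n. Qed.

Lemma frob_dgram n0 k0 (S : sym R n0) (F U : 'M[R]_(n0, k0)) :
  frob (vsval S) (vsval (dgram F U)) = 2 * frob U (vsval S *m F).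
Proof.
have ST : (vsval S)^T = vsval S by apply/memv_symV/subvsP.
rewrite /= frobDr mulr_natl mulr2n /frob !mulmxA ST; congr (_ + _).
  by rewrite mxtrace_mulC mulmxA.
by rewrite -mxtrace_tr !trmx_mul trmxK ST mxtrace_mulC.
Qed.

(** The blocks of the symmetric bilinear map with diagonal [2 * F F^T]. *)
Definition bm_polar U V : blocks R n n :=
  pack (fun c => vsval (dgram (blk c U) (blk c V))).

Lemma bm_polar_bisym : bisym bm_polar.
Proof.
split=> [U V|a U V W]; apply: blk_inj => c.
  by rewrite !packK dgramC.
rewrite blk_lin !packK blk_lin dgramPl; exact: linearP.
Qed.

Lemma bm_Dconstr_bisym : bisym (bm_Dconstr A : blocks R n k -> _).
Proof.
have symD U V : bm_Dconstr A U V = bm_Dconstr A V U.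
  by apply: eq_bigr => c _; rewrite dgramC.
by split=> // a U V W; rewrite symD linearP /= !(symD W).
Qed.

Section Cost.
Variable C : forall c, sym R (n c).

Definition bm_form U V : R := frob (pack_sym C) (bm_polar U V).

Lemma bm_form_bisym : @bisym R _ R^o bm_form.
Proof.
split=> [U V|a U V W]; first by rewrite /bm_form (bisymC bm_polar_bisym).
by rewrite /bm_form (bisymPl bm_polar_bisym) frobDr frobZr.
Qed.

Lemma bm_polar_diag F : pack_sym (bm_gram F) = 2^-1 *: bm_polar F F.
Proof.
apply: blk_inj => c; rewrite blkZ /pack_sym !packK /=.
by rewrite -mulr2n -(scaler_nat 2 (blk c F *m _)) scalerA mulVf ?scale1r ?pnatr_eq0.
Qed.

Lemma bm_costE F : bm_cost C F = 2^-1 * bm_form F F.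
Proof.
rewrite /bm_form -frobZr -bm_polar_diag frob_blocks; apply: eq_bigr => c _.
by rewrite !packK.
Qed.

Lemma bm_constrE F : bm_constr A b F = qconstr (bm_Dconstr A) b F.
Proof.
rewrite /bm_constr /qconstr; congr (_ - _); rewrite /bm_Dconstr scaler_sumr.
apply: eq_bigr => c _; rewrite dgram_diag linearZ /= scalerA mulVf ?pnatr_eq0 //.
by rewrite scale1r.
Qed.

Lemma aug_lagrangianE rho y :
  aug_lagrangian A b C rho y = qaug bm_form (bm_Dconstr A) b rho y.
Proof.
by apply/funext => F; rewrite /aug_lagrangian /qaug bm_costE bm_constrE.
Qed.

Lemma frob_slack y (X : forall c, sym R (n c)) :
  \sum_c frob (vsval (slack A C y c)) (vsval (X c)) =
  sdp_cost C X - frob y (\sum_c A c (X c)).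
Proof.
rewrite frob_sumr -sumrB; apply: eq_bigr => c _.
by rewrite linearB /= frobBl adjointP.
Qed.

Lemma qlag_bmE y U V : qlag bm_form (bm_Dconstr A) y U V =
  2 * \sum_c frob (blk c V) (vsval (slack A C y c) *m blk c U).
Proof.
have -> : 2 * \sum_c frob (blk c V) (vsval (slack A C y c) *m blk c U) =
    \sum_c frob (vsval (slack A C y c)) (vsval (dgram (blk c U) (blk c V))).
  by rewrite mulr_sumr; apply: eq_bigr => c _; rewrite frob_dgram.
rewrite (frob_slack y (fun c => dgram (blk c U) (blk c V))).
congr (_ - _); rewrite /bm_form frob_blocks; apply: eq_bigr => c _.
by rewrite !packK.
Qed.

Lemma qlag_stationary y F :
  (forall V, qlag bm_form (bm_Dconstr A) y F V = 0) <->
  (forall c, vsval (slack A C y c) *m blk c F = 0).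
Proof.
split=> [st c|st V]; last first.
  by rewrite qlag_bmE big1 ?mulr0 // => c _; rewrite st frob0r.
have := st (pack (fun c => vsval (slack A C y c) *m blk c F)).
rewrite qlag_bmE => /eqP; rewrite mulf_eq0 pnatr_eq0 /= psumr_eq0 => [/allP h|c' _].
  by have /eqP := h c (mem_index_enum c); rewrite packK => /frob_eq0.
by rewrite packK frob_ge0.
Qed.

Lemma bm_slackF y F c :
  vsval (slack A C y c) *m blk c F = blk c (bm_CF C F) - blk c (bm_B A F y).
Proof. by rewrite !packK linearB /= mulmxBl. Qed.

(** The pseudoinverse multiplier differs from a stationary one by a vector in the
    kernel of the Gram matrix [bm_G A F], which is the kernel of [bm_B A F]. *)
Lemma bm_mu_stationary y F :
  (forall c, vsval (slack A C y c) *m blk c F = 0) ->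
  forall c, vsval (bm_slack A C F c) *m blk c F = 0.
Proof.
move=> st c.
have CFE : bm_CF C F = bm_B A F y.
  by apply: blk_inj => c'; apply/eqP; rewrite -subr_eq0 -bm_slackF st.
rewrite /bm_slack bm_slackF CFE; apply/eqP; rewrite subr_eq0; apply/eqP.
congr blk; rewrite -!mul_rV_lin1; set T := lin1_mx (bm_B A F).
have GE : bm_G A F = T *m T^T.
  apply/row_matrixP => i; have -> : row i (bm_G A F) = bm_Badj A F (bm_B A F (delta_mx 0 i)).
    by apply/rowP => j; rewrite !mxE.
  by rewrite /bm_Badj -mul_rV_lin1 -/T -mulmxA -rowE.
have muE : bm_mu A C F = y *m bm_G A F *m mpinv (bm_G A F).
  by rewrite /bm_mu CFE /bm_Badj -mul_rV_lin1 -/T GE mulmxA.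
have [GPG _ _ _] := mpinvP (bm_G A F).
move: (mpinv _) GPG muE => P GPG muE.
set z := bm_mu A C F - y.
have zG : z *m (T *m T^T) = 0.
  by rewrite -GE /z mulmxBl muE -!mulmxA [bm_G A F *m (_ *m _)]mulmxA GPG subrr.
have : z *m T = 0.
  apply: frob_eq0; rewrite frob_row trmx_mul mulmxA -[z *m T *m _]mulmxA zG.
  by rewrite mul0mx mxE.
by rewrite /z mulmxBl => /eqP; rewrite subr_eq0 => /eqP.
Qed.

End Cost.

(** The limit of the multipliers is stationary, so the pseudoinverse multiplier
    is as well, and the curvature condition transfers to it. *)
Lemma alm_second_order_critical (C : forall c, sym R (n c)) (theta gamma : R)
    (omega zeta : nat -> R) (F : nat -> blocks R n k) (y : nat -> 'rV[R]_m)
    (rho : nat -> R) (Fs : blocks R n k) :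
  fixed_rank_alm A b C theta gamma omega zeta F y rho ->
  accumulation_point F Fs -> second_order_critical A b C Fs.
Proof.
move=> [th ga upd _ [W [oW feasO [r rkO]]] [gr he com cze] [r0 [M yM] rule]] acc.
have [|||||fs [ybar st soc]] := @alm_limit_point R _ m (bm_form C) (bm_Dconstr A)
  b (bm_form_bisym C) bm_Dconstr_bisym theta gamma M omega zeta F y rho th ga
  _ _ _ com cze r0 yM _ W r Fs oW _ rkO acc.
- by move=> l; rewrite upd bm_constrE.
- by move=> l; rewrite -aug_lagrangianE.
- by move=> l; rewrite -aug_lagrangianE.
- by move=> l; rewrite rule !bm_constrE.
- by move=> G G0; apply: feasO; rewrite /bm_feasible /= bm_constrE.
have stB := bm_mu_stationary ((qlag_stationary _ _ _).1 st).
split; [by rewrite bm_constrE|exact: stB|move=> U DU].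
have := soc (bm_mu A C Fs) U ((qlag_stationary _ _ _).2 stB) DU.
by rewrite qlag_bmE pmulr_rge0.
Qed.

End FactoredProblem.

(** * Dual certificates *)

Section Psd.
Context {R : realType} {n : nat}.
Implicit Types (S Y : 'M[R]_n) (u v : 'rV[R]_n).

Definition rform Y u v : R := frob (u *m Y) v.

Lemma rform_bisym Y : Y^T = Y -> @bisym R n R^o (rform Y).
Proof.
move=> Ys; split=> [u v|a u v w]; first by rewrite /rform frob_mulmxr // frobC.
by rewrite /rform mulmxDl -scalemxAl frobDl frobZl.
Qed.

Lemma rform_delta Y i v : rform Y (delta_mx 0 i) v = (row i Y *m v^T) 0 0.
Proof. by rewrite /rform -rowE frob_row. Qed.

Lemma rform_entry Y i j : rform Y (delta_mx 0 i) (delta_mx 0 j) = Y i j.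
Proof. by rewrite rform_delta trmx_delta -colE !mxE. Qed.

Lemma psd_rform (X : sym R n) : psd X <-> forall u, 0 <= rform (vsval X) u u.
Proof.
split=> h u; rewrite /rform ?frob_row; last by have := h u^T; rewrite /rform frob_row trmxK.
by have := h u^T; rewrite trmxK.
Qed.

(** Subtracting from a positive semidefinite [Y] the rank-one matrix
    [Y i i ^-1 u^T u], with [u] the row i, leaves a positive semidefinite matrix
    with one more zero on the diagonal.  Hence [Y] is a sum of rank-one terms,
    each of which pairs nonnegatively with [S]. *)
Lemma frob_psd_ge0 S Y : Y^T = Y -> (forall u, 0 <= rform S u u) ->
  (forall u, 0 <= rform Y u u) -> 0 <= frob S Y.
Proof.
move=> + Sp; move: {2}#|_| (leqnn #|[pred i | Y i i != 0]|) => d.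
elim: d Y => [|d IH] Y cardY Ys Yp.
  have Y0 i : Y i i = 0.
    apply: contraTeq cardY => Yi; rewrite leqn0.
    by apply/pred0Pn; exists i.
  suff -> : Y = 0 by rewrite frob0r.
  apply/matrixP => i j; rewrite mxE.
  suff : 2 * Y i j = 0 by move/eqP; rewrite mulf_eq0 pnatr_eq0 => /eqP.
  apply: (@linear_coef_eq0 _ _ 0) => t.
  have := Yp (t *: delta_mx 0 j + delta_mx 0 i).
  rewrite (form_line (rform_bisym Ys)) !rform_entry !Y0; congr (0 <= _); ring.
have [[i Yi]|nex] := pselect (exists i, Y i i != 0); last first.
  apply: IH => //; rewrite eq_card0 // => i; rewrite inE.
  by apply/negbTE/negP => Yi; apply: nex; exists i.
have a0 : 0 < Y i i by rewrite lt_def Yi -[Y i i]rform_entry Yp.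
set a := Y i i in Yi a0; pose w := row i Y.
pose Y' := Y - a^-1 *: (w^T *m w).
have Y'E u : rform Y' u u = rform Y u u - a^-1 * rform Y (delta_mx 0 i) u ^+ 2.
  rewrite /rform mulmxBr frobBl; congr (_ - _).
  rewrite -scalemxAr frobZl; congr (_ * _).
  rewrite -rowE -/w !frob_row mulmxA -[u *m _ *m w *m _]mulmxA [LHS]mxE big_ord1.
  by rewrite -!frob_row frobC expr2.
have Y's : Y'^T = Y' by rewrite linearB linearZ /= Ys trmx_mul trmxK.
have Y'p u : 0 <= rform Y' u u.
  rewrite Y'E; have := Yp ((- (a^-1 * rform Y (delta_mx 0 i) u)) *: delta_mx 0 i + u).
  rewrite (form_line (rform_bisym Ys)) rform_entry -/a.
  rewrite (bisymC (rform_bisym Ys) u); congr (0 <= _).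
  by field.
have -> : Y = Y' + a^-1 *: (w^T *m w) by rewrite subrK.
rewrite frobDr addr_ge0 //.
  apply: IH => //; rewrite -ltnS; apply: leq_trans cardY.
  apply: proper_card; apply/properP; split; last first.
    exists i; rewrite !inE ?Yi // negbK.
    rewrite -[Y' i i]rform_entry Y'E !rform_entry -/a; apply/eqP; field.
    exact: Yi.
  apply/fintype.subsetP => j; rewrite !inE; apply: contra_neq => Yj.
  apply/eqP; rewrite eq_le -{2}[Y' j j]rform_entry Y'p andbT.
  rewrite -[Y' j j]rform_entry Y'E rform_entry Yj sub0r oppr_le0.
  by rewrite mulr_ge0 ?sqr_ge0 // invr_ge0 ltW.
rewrite frobZr; apply: mulr_ge0; first by rewrite invr_ge0 ltW.
have := Sp w; rewrite /rform frob_row; congr (0 <= _).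
rewrite [RHS]frobC /frob trmx_mul trmxK -[in RHS]mulmxA mxtrace_mulC.
by rewrite /mxtrace big_ord1.
Qed.

Lemma frob_psd (S Y : sym R n) : psd S -> psd Y -> 0 <= frob (vsval S) (vsval Y).
Proof.
move=> /psd_rform Sp /psd_rform Yp; apply: frob_psd_ge0 => //.
exact/memv_symV/subvsP.
Qed.

Lemma psd_gram k (F : 'M[R]_(n, k)) : psd (gram F).
Proof.
move=> v; rewrite /= mulmxA -mulmxA -[F^T *m v]trmxK trmx_mul trmxK.
by rewrite -frob_row frob_ge0.
Qed.

End Psd.

Section GlobalOptimality.
Context {R : realType} {q m : nat} {n k : 'I_q -> nat}.
Variables (A : forall c, 'Hom(sym R (n c), 'rV[R]_m)) (b : 'rV[R]_m).
Variable C : forall c, sym R (n c).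

(** Weak duality with complementary slackness. *)
Lemma dual_optimal (X : forall c, sym R (n c)) y :
  sdp_feasible A b X -> (forall c, psd (slack A C y c)) ->
  (forall c, frob (vsval (slack A C y c)) (vsval (X c)) = 0) ->
  sdp_optimal A b C X.
Proof.
move=> feasX psdS comp; split=> // Y [psdY feasY].
have := frob_slack A C y X; have := frob_slack A C y Y.
rewrite feasX.2 feasY [in X in _ -> X = _ -> _]big1 // => eY eX.
have : 0 <= \sum_c frob (vsval (slack A C y c)) (vsval (Y c)).
  by apply: sumr_ge0 => c _; exact: frob_psd.
by rewrite eY; lra.
Qed.

(** A factor block with dependent columns leaves room for directions [v z^T],
    with [z] in the kernel of the block, that do not change the constraints to
    first order; the second-order condition along them is positivity of the
    slack. *)
Lemma critical_deficient_psd (F : blocks R n k) c :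
  second_order_critical A b C F -> (\rank (blk c F) < k c)%N ->
  psd (bm_slack A C F c).
Proof.
move=> [_ _ soc] rkF v; move: (bm_slack A C F) soc => S soc.
have [z z0 zF] : exists2 z : 'rV[R]_(k c), z != 0 & blk c F *m z^T = 0.
  have : kermx (blk c F)^T != 0.
    by rewrite kermx_eq0 /row_free mxrank_tr neq_ltn rkF.
  case/rowV0Pn => z /sub_kermxP zF z0; exists z => //.
  by rewrite -[blk c F]trmxK -trmx_mul zF trmx0.
pose Ub := dfwith (fun c' => 0 : 'M[R]_(n c', k c')) c (v *m z).
have := soc (pack Ub).
have Uc : blk c (pack Ub) = v *m z by rewrite packK /Ub dfwithin.
have Uc' c' : c' != c -> blk c' (pack Ub) = 0.
  by move=> cc'; rewrite packK /Ub dfwithout // eq_sym.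
rewrite (bigD1 c) //= Uc big1 => [|c' cc']; last by rewrite Uc' // mulmx0 frob0r.
rewrite addr0 => pos; have zz : 0 < frob z z.
  by rewrite lt_def frob_ge0 andbT; apply: contra_neq z0 => /frob_eq0.
rewrite -(pmulr_lge0 _ zz); apply: le_trans (pos _) _.
  rewrite /bm_Dconstr big1 // => c' _.
  have -> : dgram (blk c' F) (blk c' (pack Ub)) = 0; last by rewrite linear0.
  apply: subvs_inj; rewrite linear0 /=; have [->|cc'] := eqVneq c' c.
    rewrite Uc trmx_mul mulmxA zF mul0mx add0r -mulmxA.
    by rewrite -[z *m _]trmxK trmx_mul trmxK zF trmx0 mulmx0.
  by rewrite Uc' // trmx0 mulmx0 mul0mx addr0.
rewrite /frob trmx_mul -[z^T *m v^T *m _]mulmxA mxtrace_mulC !mulmxA -[_ *m v *m z *m _]mulmxA.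
rewrite [X in \tr (X *m _) <= _]mx11_scalar mul_scalar_mx mxtraceZ.
by rewrite [X in _ * X <= _]mxtrace_mulC.
Qed.

(** Every block yields a positive semidefinite slack, by the second-order condition
    if its columns are dependent and by stationarity if it is invertible; the
    pseudoinverse multiplier is then a dual certificate. *)
Lemma critical_optimal (F : blocks R n k) :
  second_order_critical A b C F ->
  (forall c, (n c <= k c)%N \/ (\rank (blk c F) < k c)%N) ->
  sdp_optimal A b C (bm_gram F).
Proof.
move=> crit blkF; have [feas st _] := crit.
apply: (dual_optimal (y := bm_mu A C F)) => [|c|c].
- split=> [c|]; first exact: psd_gram.
  by apply/eqP; rewrite -subr_eq0; apply/eqP.
- have [rkF|] := ltnP (\rank (blk c F)) (k c); first exact: critical_deficient_psd.
  case: (blkF c) => [nk kr|]; last by rewrite ltnNge => /negPf ->.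
  (* full row rank: stationarity forces the slack to vanish *)
  have Ff : row_free (blk c F).
    by rewrite /row_free eqn_leq rank_leq_row (leq_trans nk).
  have S0 : vsval (slack A C (bm_mu A C F) c) = 0.
    by apply: (row_free_inj Ff); rewrite mul0mx; exact: st.
  by move=> v; rewrite S0 mulmx0 mul0mx mxE.
- have := frob_dgram (slack A C (bm_mu A C F) c) (blk c F) (blk c F).
  rewrite st frob0r mulr0 dgram_diag linearZ frobZr => /eqP.
  by rewrite mulf_eq0 pnatr_eq0 => /eqP.
Qed.

Lemma sdp_value_optimal (X : forall c, sym R (n c)) :
  sdp_optimal A b C X -> sdp_value A b C = sdp_cost C X.
Proof.
move=> [feasX optX]; apply/eqP; rewrite eq_le; apply/andP; split.
  by apply: ge_inf; [exists (sdp_cost C X) => _ [Y ? <-]; exact: optX|exists X].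
by apply: lb_le_inf; [exists (sdp_cost C X), X|move=> _ [Y ? <-]; exact: optX].
Qed.

(** Otherwise the terms outside of [U] would accumulate in [K]. *)
Lemma compact_cluster_near (T : topologicalType) (K U : set T) (x : nat -> T) :
  compact K -> (forall l, K (x l)) ->
  (forall p, cluster (x @ \oo) p -> nbhs p U) -> \forall l \near \oo, U (x l).
Proof.
move=> cK xK nU; apply: contrapT => notU.
have often N : exists2 l, (N <= l)%N & ~ U (x l).
  apply: contrapT => nex; apply: notU; exists N => // l /= Nl.
  by apply: contrapT => nUl; apply: nex; exists l.
pose B : set_system T := [set S | exists N, forall l, (N <= l)%N ->
  ~ U (x l) -> S (x l)].
have FB : ProperFilter B.
  split; first by case=> N BN; have [l Nl nUl] := often N; exact: BN Nl nUl.
  split; first by exists 0%N.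
    move=> S S' [N SN] [N' S'N]; exists (maxn N N') => l.
    by rewrite geq_max => /andP[Nl N'l] nUl; split; [exact: SN|exact: S'N].
  by move=> S S' SS' [N SN]; exists N => l Nl nUl; apply: SS'; exact: SN.
have [|p [_ clp]] := cK B FB; first by exists 0%N.
have pU : nbhs p U.
  apply: nU => S V [N _ NS]; apply: clp; exists N => l Nl _; exact: NS.
have [|z []] := clp (~` U) U _ pU; last by [].
by exists 0%N.
Qed.

Lemma sdp_dist_le (X Y : forall c, sym R (n c)) (S : set (forall c, sym R (n c))) :
  S Y -> 0 <= sdp_dist X S <= fnorm (pack_sym X - pack_sym Y).
Proof.
move=> SY; apply/andP; split.
  by apply: lb_le_inf; [exists (fnorm (pack_sym X - pack_sym Y)), Y
    |move=> _ [Z _ <-]; exact: fnorm_ge0].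
apply: ge_inf; last by exists Y.
by exists 0 => _ [Z _ <-]; exact: fnorm_ge0.
Qed.

(** Near an accumulation point the distance to the solution set is at most the
    distance to the Gram matrices of this point. *)
Lemma accumulation_optimal_convergence (K : set (blocks R n k))
    (F : nat -> blocks R n k) :
  compact K -> (forall l, K (F l)) ->
  (forall G, accumulation_point F G -> sdp_optimal A b C (bm_gram G)) ->
  sdp_convergence A b C F.
Proof.
move=> cK FK opt.
have mid (p : blocks R n k) : mcvg (nbhs p) id p by exact: cvg_mcvg cvg_id.
split=> //.
  apply/cvgrPdist_lt => e e0.
  apply: (compact_cluster_near (U := [set G | `|sdp_value A b C - bm_cost C G| < e])
    cK FK) => p clp; rewrite (sdp_value_optimal (opt _ clp)).
  have cp : bm_cost C G @[G --> p] --> bm_cost C p.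
    rewrite bm_costE; under eq_cvg do rewrite bm_costE.
    have cf : bm_form C G G @[G --> p] --> bm_form C p p.
      exact: (bisym_cvg (mid p) (mid p) (bm_form_bisym C)).
    exact: (cvgM (cvg_cst (2^-1 : R)) cf).
  by move/cvgrPdist_lt: cp => /(_ _ e0).
apply/cvgrPdist_lt => e e0.
pose U := [set G : blocks R n k | `|0 - sdp_dist (bm_gram G) (sdp_optimal A b C)| < e].
apply: (compact_cluster_near (U := U) cK FK) => p clp.
have cp : fnorm (pack_sym (bm_gram G) - pack_sym (bm_gram p)) @[G --> p] --> (0 : R).
  have -> : 0 = fnorm (pack_sym (bm_gram p) - pack_sym (bm_gram p)).
    by rewrite subrr /fnorm frob0r sqrtr0.
  have cpol : mcvg (nbhs p) (fun G => bm_polar G G) (bm_polar p p).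
    exact: (bisym_mcvg (mid p) (mid p) bm_polar_bisym).
  have cg : mcvg (nbhs p) (fun G => pack_sym (bm_gram G)) (pack_sym (bm_gram p)).
    rewrite bm_polar_diag; under [X in mcvg _ X _]eq_fun do rewrite bm_polar_diag.
    exact: (mcvgZ (cvg_cst (2^-1 : R)) cpol).
  exact: (mcvg_fnorm (mcvgB cg (mcvg_cst _))).
move/cvgrPdist_lt: cp => /(_ _ e0); apply: filterS => G.
rewrite /U /= ![`|0 - _|]distrC !subr0.
have /andP[d0 dle] := sdp_dist_le (bm_gram G) (opt _ clp).
by rewrite !ger0_norm ?fnorm_ge0 //; exact: le_lt_trans dle.
Qed.

End GlobalOptimality.

(** * Null sets of symmetric block matrices *)

Section NullSets.
Context {R : realType} {q : nat} {n : 'I_q -> nat}.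
Variable c0 : 'I_q.
Hypothesis n_gt0 : (0 < n c0)%N.

Lemma sym_box_volume_ge0 (lo hi : forall c, 'M[R]_(n c)) :
  (forall c (i j : 'I_(n c)), (i <= j)%N -> lo c i j <= hi c i j) ->
  0 <= sym_box_volume lo hi.
Proof.
move=> le; apply: prodr_ge0 => c _; apply: prodr_ge0 => i _.
by apply: prodr_ge0 => j ij; rewrite subr_ge0 le.
Qed.

Lemma sym_box_volume_point (p : forall c, 'M[R]_(n c)) : sym_box_volume p p = 0.
Proof.
rewrite /sym_box_volume (bigD1 c0) //= (bigD1 (Ordinal n_gt0)) //=.
by rewrite (bigD1 (Ordinal n_gt0)) //= subrr !mul0r.
Qed.

(** Covers indexed by any countable type, with bounded finite partial sums, can
    be enumerated along the integers; degenerate boxes fill the gaps. *)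
Lemma lebesgue_null_cover (E : set (forall c, sym R (n c))) :
  (forall e : R, 0 < e -> exists (J : countType) (lo hi : J -> forall c, 'M[R]_(n c)),
    [/\ forall j c (a d : 'I_(n c)), (a <= d)%N -> lo j c a d <= hi j c a d,
        forall X, E X -> exists j, sym_box (lo j) (hi j) X &
        forall s : seq J, uniq s ->
          \sum_(j <- s) sym_box_volume (lo j) (hi j) <= e]) ->
  lebesgue_null E.
Proof.
move=> cover e e0; have [J [lo [hi [lohi EJ sumJ]]]] := cover e e0.
pose ext (f : J -> forall c, 'M[R]_(n c)) l :=
  if pickle_inv l is Some j then f j else fun=> 0.
have extlohi l c (a d : 'I_(n c)) : (a <= d)%N -> ext lo l c a d <= ext hi l c a d.
  by move=> ad; rewrite /ext; case: pickle_inv => // j; exact: lohi.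
exists (ext lo), (ext hi); split => [||].
- exact: extlohi.
- move=> X /EJ[j Xj]; exists (pickle j) => //.
  by rewrite /ext pickleK_inv.
have volE (s : seq nat) : \sum_(l <- s) sym_box_volume (ext lo l) (ext hi l) =
    \sum_(j <- pmap pickle_inv s) sym_box_volume (lo j) (hi j).
  elim: s => [|l s IH]; first by rewrite !big_nil.
  rewrite big_cons IH /ext /=; case: (pickle_inv l) => [j|] /=.
    by rewrite big_cons.
  by rewrite sym_box_volume_point add0r.
apply: lime_le.
  by apply: is_cvg_nneseries => l _ _; rewrite lee_fin; exact/sym_box_volume_ge0/extlohi.
apply: nearW => N; rewrite sumEFin lee_fin volE; apply: sumJ.
by apply: (pmap_uniq (@pickle_invK J)); exact: iota_uniq.
Qed.

Lemma lebesgue_null_sub (E E' : set (forall c, sym R (n c))) :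
  E `<=` E' -> lebesgue_null E' -> lebesgue_null E.
Proof.
move=> EE' nE' e e0; have [lo [hi [le cov vol]]] := nE' e e0.
by exists lo, hi; split=> //; exact: subset_trans cov.
Qed.

Lemma lebesgue_null0 : lebesgue_null (set0 : set (forall c, sym R (n c))).
Proof.
apply: lebesgue_null_cover => e e0.
exists 'I_0, (fun _ _ => 0), (fun _ _ => 0); split=> // s _.
by rewrite big1 ?ltW // => -[].
Qed.

Lemma ler_sum_subseq (J : eqType) (f : J -> R) (s s' : seq J) :
  (forall j, 0 <= f j) -> uniq s -> {subset s <= s'} ->
  \sum_(j <- s) f j <= \sum_(j <- s') f j.
Proof.
move=> f0; elim: s s' => [|j s IH] s' /=.
  by rewrite big_nil => _ _; exact: sumr_ge0.
move=> /andP[js us] ss'; have js' : j \in s' by apply: ss'; rewrite mem_head.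
rewrite big_cons (perm_big _ (perm_to_rem js')) big_cons lerD2l.
apply: IH => // i is_; have ij : i != j by apply: contraNneq js => <-.
have : i \in s' by apply: ss'; rewrite inE is_ orbT.
by rewrite (perm_mem (perm_to_rem js')) inE (negPf ij).
Qed.

(** The cover of the i-th set uses a budget of [e / 2 ^ i.+1]; a finite family of
    boxes from the double sequence lies in a finite rectangle of indices. *)
Lemma lebesgue_null_bigcup (I : countType) (E : I -> set (forall c, sym R (n c))) :
  (forall i, lebesgue_null (E i)) -> lebesgue_null (\bigcup_i E i).
Proof.
move=> nE; apply: lebesgue_null_cover => e e0.
pose w l : R := e / 2 ^+ l.+1.
have w0 l : 0 < w l by rewrite divr_gt0 // exprn_gt0.
have wsum N : \sum_(l <- iota 0 N) w l <= e.
  rewrite -[N]subn0 -/(index_iota 0 N).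
  suff -> : \sum_(0 <= l < N) w l = e - e / 2 ^+ N.
    by rewrite gerBl divr_ge0 ?exprn_ge0 // ltW.
  elim: N => [|N IH]; first by rewrite big_nil expr0 divr1 subrr.
  rewrite big_nat_recr //= IH /w exprS invfM; field; rewrite expf_neq0 ?pnatr_eq0 //.
have cov i := cid (nE i (w (pickle i)) (w0 _)).
pose lo i := projT1 (cov i).
have cov2 i := cid (projT2 (cov i)).
pose hi i := projT1 (cov2 i).
have le i l c (a d : 'I_(n c)) : (a <= d)%N -> lo i l c a d <= hi i l c a d.
  by have [+ _ _] := projT2 (cov2 i); exact.
have sub i : E i `<=` \bigcup_l sym_box (lo i l) (hi i l).
  by have [_ + _] := projT2 (cov2 i).
pose vol i l := sym_box_volume (lo i l) (hi i l).
have vol0 i l : 0 <= vol i l by apply: sym_box_volume_ge0; exact: le.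
have partial i N : \sum_(l <- iota 0 N) vol i l <= w (pickle i).
  have [_ _ +] := projT2 (cov2 i); rewrite -lee_fin; apply: le_trans.
  rewrite -sumEFin -[N]subn0 -/(index_iota 0 N).
  by apply: (@nneseries_lim_ge _ (fun l => (vol i l)%:E)) => l _ _; rewrite lee_fin.
exists (I * nat)%type, (fun p => lo p.1 p.2), (fun p => hi p.1 p.2); split.
- by move=> [i l] c a d ad; exact: le.
- by move=> X [i _ /sub[l _ Xl]]; exists (i, l).
move=> s us; pose N := (\max_(p <- s) p.2).+1.
pose u := undup [seq p.1 | p <- s].
have -> : \sum_(j <- s) sym_box_volume (lo j.1 j.2) (hi j.1 j.2) =
  \sum_(j <- s) vol j.1 j.2 by [].
apply: (@le_trans _ _ (\sum_(p <- [seq (i, l) | i <- u, l <- iota 0 N]) vol p.1 p.2)).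
  apply: ler_sum_subseq => // p ps; apply/allpairsP; exists p; split.
  - by rewrite mem_undup map_f.
  - by rewrite mem_iota /= add0n ltnS; exact: leq_bigmax_seq.
  - by case: p {ps}.
rewrite big_allpairs; apply: (@le_trans _ _ (\sum_(i <- u) w (pickle i))).
  by apply: ler_sum => i _; exact: partial.
rewrite -(big_map pickle xpredT w).
apply: le_trans (wsum (\max_(l <- [seq pickle i | i <- u]) l).+1).
apply: ler_sum_subseq => [l||l lu]; first exact: ltW.
  by rewrite map_inj_uniq ?undup_uniq //; exact: (pcan_inj pickleK).
by rewrite mem_iota /= add0n ltnS; exact: (@leq_bigmax_seq _ _ xpredT id).
Qed.

End NullSets.

Section LipschitzImages.
Context {R : realType} {T : finType} (D : pred T).
Implicit Types (x : T -> R) (f g : (T -> R) -> R).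

(** The distance only looks at the coordinates in [D], which encodes that the
    function depends on these coordinates alone.  Boundedness is included for
    the sake of products. *)
Definition tame f : Prop := forall M : R, exists B : R,
  [/\ 0 <= B, forall x, (forall t, `|x t| <= M) -> `|f x| <= B &
    forall x x' d, 0 <= d ->
      (forall t, `|x t| <= M) -> (forall t, `|x' t| <= M) ->
      (forall t, D t -> `|x t - x' t| <= d) -> `|f x - f x'| <= B * d].

Lemma tame_cst a : tame (fun=> a).
Proof.
move=> M; exists `|a|; split=> // x x' d d0 _ _ _.
by rewrite subrr normr0 mulr_ge0.
Qed.

Lemma tame_coord t : D t -> tame (fun x => x t).
Proof.
move=> Dt M; exists (`|M| + 1); split=> [|x xM|x x' d d0 _ _ cl].
- by rewrite addr_ge0.
- by apply: le_trans (xM t) _; rewrite (le_trans (ler_norm M)) // lerDl.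
- by apply: le_trans (cl t Dt) _; rewrite ler_peMl // lerDr.
Qed.

Lemma tameD f g : tame f -> tame g -> tame (fun x => f x + g x).
Proof.
move=> tf tg M; have [B [B0 fB fL]] := tf M; have [B' [B'0 gB gL]] := tg M.
exists (B + B'); split=> [|x xM|x x' d d0 xM x'M cl].
- exact: addr_ge0.
- by apply: le_trans (ler_normD _ _) _; rewrite lerD ?fB ?gB.
- rewrite opprD addrACA mulrDl; apply: le_trans (ler_normD _ _) _.
  by rewrite lerD ?fL ?gL.
Qed.

Lemma tameM f g : tame f -> tame g -> tame (fun x => f x * g x).
Proof.
move=> tf tg M; have [B [B0 fB fL]] := tf M; have [B' [B'0 gB gL]] := tg M.
exists (2 * (B * B')); split=> [|x xM|x x' d d0 xM x'M cl].
- by rewrite !mulr_ge0.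
- rewrite normrM; apply: (@le_trans _ _ (B * B')).
    by apply: ler_pM; rewrite ?fB ?gB.
  by rewrite ler_peMl ?mulr_ge0 // ler1n.
- have -> : f x * g x - f x' * g x' = f x * (g x - g x') + (f x - f x') * g x'.
    by ring.
  apply: le_trans (ler_normD _ _) _; rewrite !normrM.
  have -> : 2 * (B * B') * d = B * (B' * d) + B * d * B' by ring.
  by apply: lerD; apply: ler_pM; rewrite ?fB ?gB ?fL ?gL.
Qed.

Lemma tameN f : tame f -> tame (fun x => - f x).
Proof.
move=> tf; have -> : (fun x => - f x) = (fun x => -1 * f x).
  by apply/funext => x; rewrite mulN1r.
by apply: tameM => //; exact: tame_cst.
Qed.

Lemma tame_sum (I : Type) (r : seq I) (P : pred I) (F : I -> (T -> R) -> R) :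
  (forall i, P i -> tame (F i)) -> tame (fun x => \sum_(i <- r | P i) F i x).
Proof.
move=> tF; elim: r => [|i r IH].
  have -> : (fun x => \sum_(i <- [::] | P i) F i x) = (fun=> 0).
    by apply/funext => x; rewrite big_nil.
  exact: tame_cst.
have -> : (fun x => \sum_(j <- i :: r | P j) F j x) =
    (fun x => (if P i then F i x else 0) + \sum_(j <- r | P j) F j x).
  by apply/funext => x; rewrite big_cons; case: (P i); rewrite ?add0r.
apply: tameD => //; case: (boolP (P i)) => [/tF//|_]; exact: tame_cst.
Qed.

Lemma nearest_index (K : nat) (z : R) :
  0 <= z <= K.+1%:R -> exists g : 'I_K.+1, `|z - g%:R| <= 1.
Proof.
elim: K => [|K IH] /andP[z0 zK].
  by exists ord0; rewrite subr0 ger0_norm.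
have [zle|zgt] := leP z K.+1%:R.
  have [|g gz] := IH; first by rewrite z0.
  by exists (widen_ord (leqnSn _) g).
exists ord_max; rewrite ger0_norm /=; last by rewrite subr_ge0 ltW.
by rewrite lerBlDr nat1r.
Qed.

End LipschitzImages.

Section LipschitzNull.
Context {R : realType} {q : nat} {n : 'I_q -> nat}.
Variable c0 : 'I_q.
Hypothesis n_gt0 : (0 < n c0)%N.

(** All entries count as coordinates, to keep the type simple; the independent
    ones are those in [upper]. *)
Definition coords : finType := {c : 'I_q & ('I_(n c) * 'I_(n c))%type}.

Definition coord_at c (i j : 'I_(n c)) : coords := Tagged _ (i, j).

Definition upper (t : coords) : bool := ((tagged t).1 <= (tagged t).2)%N.

Lemma sym_cube_volume (lo hi : forall c, 'M[R]_(n c)) (w : R) :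
  (forall c i j, hi c i j - lo c i j = w) -> sym_box_volume lo hi = w ^+ #|upper|.
Proof.
move=> whl; rewrite -prodr_const.
have -> : \prod_(t in upper) w =
    \prod_(t : coords | true && upper t) w by [].
rewrite -(sig_big_dep (fun c => true) (fun c (p : 'I_(n c) * 'I_(n c)) => (p.1 <= p.2)%N)
  (fun _ _ => w)) /=.
apply: eq_bigr => c _; rewrite pair_big_dep /=.
by apply: eq_bigr => p _; exact: whl.
Qed.

(** A bounded part of the image is covered by the images of the cells of a grid
    with mesh 1/K; there are K^d of them, with d less than the dimension N, and
    each is contained in a cube with volume O(K^-N). *)
Lemma tame_image_null (D : pred coords) (h : coords -> (coords -> R) -> R) :
  (#|D| < #|upper|)%N -> (forall t, tame D (h t)) ->
  lebesgue_null [set X : (forall c, sym R (n c)) | exists x, forall c (i j : 'I_(n c)),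
    (i <= j)%N -> (vsval (X c) : 'M[R]_(n c)) i j = h (coord_at i j) x].
Proof.
move=> ltD th.
pose E (M : nat) := [set X : (forall c, sym R (n c)) | exists2 x,
  forall t, `|x t| <= M.+1%:R & forall c (i j : 'I_(n c)),
    (i <= j)%N -> (vsval (X c) : 'M[R]_(n c)) i j = h (coord_at i j) x].
apply: (@lebesgue_null_sub _ _ _ _ (\bigcup_M E M)).
  move=> X [x hx]; pose s := \sum_t `|x t|.
  exists (Num.trunc s) => //; exists x => // t.
  apply: (@le_trans _ _ s); last by rewrite ltW // truncnS_gt.
  by rewrite /s (bigD1 t) //= lerDl sumr_ge0.
apply: (lebesgue_null_bigcup n_gt0) => M.
apply: (lebesgue_null_cover n_gt0) => e e0.
pose m : R := M.+1%:R; have m0 : 0 < m by rewrite ltr0n.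
pose Bt t := projT1 (cid (th t m)); pose B := \sum_t Bt t.
have BtP t := projT2 (cid (th t m)).
have Bt0 t : 0 <= Bt t by have [] := BtP t.
have BtB t : Bt t <= B by rewrite /B (bigD1 t) //= lerDl sumr_ge0.
have B0 : 0 <= B by apply: sumr_ge0.
pose N := #|upper|; pose a : R := 4 * B * m.
pose K := Num.trunc (a ^+ N / e).
have Kgt : a ^+ N / e < K.+1%:R by rewrite truncnS_gt.
pose d : R := 2 * m / K.+1%:R.
have d0 : 0 <= d by rewrite divr_ge0 // mulr_ge0 // ltW.
pose J := {ffun {t | D t} -> 'I_K.+1}.
pose x (g : J) (t : coords) : R :=
  if insub t is Some u then d * (g u)%:R - m else 0.
pose lo (g : J) c : 'M[R]_(n c) := \matrix_(i, j) (h (coord_at i j) (x g) - B * d).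
pose hi (g : J) c : 'M[R]_(n c) := \matrix_(i, j) (h (coord_at i j) (x g) + B * d).
have Kd : K.+1%:R * d = 2 * m by rewrite /d mulrC divfK ?pnatr_eq0.
have xm (g : J) t : `|x g t| <= m.
  rewrite /x; case: insub => [u|]; last by rewrite normr0 ltW.
  have dg0 : 0 <= d * (g u)%:R by rewrite mulr_ge0.
  have dgm : d * (g u)%:R <= 2 * m.
    by rewrite -Kd mulrC ler_wpM2r // ler_nat ltnW.
  rewrite ler_norml; apply/andP; split; lra.
exists J, lo, hi; split.
- by move=> g c i j _; rewrite /lo /hi !mxE lerD2l (le_trans _ (mulr_ge0 B0 d0)) // oppr_le0 mulr_ge0.
- move=> X [z zm zX].
  have cell (u : {t | D t}) : exists g : 'I_K.+1, `|z (val u) - (d * g%:R - m)| <= d.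
    have dp : 0 < d by rewrite divr_gt0 ?mulr_gt0.
    have [|g gz] := @nearest_index R K ((z (val u) + m) / d).
      have := zm (val u); rewrite ler_norml => /andP[zl zu].
      rewrite divr_ge0 //=; last by rewrite -lerBlDr sub0r.
      by rewrite ler_pdivrMr // Kd mulr_natl mulr2n lerD2r.
    exists g; have -> : z (val u) - (d * g%:R - m) = d * ((z (val u) + m) / d - g%:R).
      by field; exact: lt0r_neq0.
    by rewrite normrM gtr0_norm // ger_pMr.
  pose g : J := [ffun u => projT1 (cid (cell u))].
  exists g => c i j ij; rewrite zX //.
  suff : `|h (coord_at i j) z - h (coord_at i j) (x g)| <= B * d.
    by rewrite ler_norml lerBrDl [X in _ && X]lerBlDl => le; rewrite /lo /hi !mxE.
  have [_ _ L] := BtP (coord_at i j).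
  have Lc := L z (x g) d d0 zm (xm g).
  apply: (@le_trans _ _ (Bt (coord_at i j) * d)); last by rewrite ler_wpM2r.
  apply: Lc.
  move=> t Dt; rewrite /x (insubT D Dt) ffunE.
  exact: (projT2 (cid (cell (Sub t Dt)))).
have volJ g : sym_box_volume (lo g) (hi g) = (2 * (B * d)) ^+ N.
  by apply: sym_cube_volume => c i j; rewrite /lo /hi !mxE; ring.
move=> s us; rewrite (eq_bigr _ (fun g _ => volJ g)).
rewrite big_const_seq count_predT iter_addr_0.
have sz : (size s <= K.+1 ^ #|D|)%N.
  rewrite -(card_uniqP us); apply: leq_trans (max_card _) _.
  by rewrite card_ffun card_ord card_sig.
have wE : 2 * (B * d) = a / K.+1%:R by rewrite /d /a !mulrA; congr (_ / _); ring.
have a0 : 0 <= a by rewrite !mulr_ge0 // ltW.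
rewrite wE -[_ *+ size s]mulr_natr expr_div_n -mulrA.
have KN : (K.+1%:R ^+ N)^-1 * (size s)%:R <= K.+1%:R^-1 :> R.
  rewrite mulrC ler_pdivrMr ?exprn_gt0 //.
  rewrite ler_pdivlMl // -natrX -natrM ler_nat.
  apply: (@leq_trans (K.+1 * K.+1 ^ #|D|)); first by rewrite leq_mul2l sz.
  by rewrite -expnS leq_pexp2l.
apply: le_trans (ler_wpM2l (exprn_ge0 _ a0) KN) _.
by rewrite ler_pdivrMr // mulrC -ler_pdivrMr // ltW.
Qed.

End LipschitzNull.

(** * The exceptional costs *)

Section PairCount.
Variable T : nat.

(** Ordered pairs cover the square twice, except for the diagonal. *)
Lemma card_ordered_pairs (I : {set 'I_T}) :
  #|[set p : 'I_T * 'I_T | [&& (p.1 <= p.2)%N, p.1 \in I & p.2 \in I]]%SET| =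
  tau #|I|.
Proof.
set S := finset _.
pose sw (p : 'I_T * 'I_T) := (p.2, p.1).
have swK : involutive sw by case.
have cardS' : #|(sw @: S)%SET| = #|S| by rewrite card_imset //; exact: inv_inj.
have S'E p : (p \in (sw @: S)%SET) = [&& (p.2 <= p.1)%N, p.1 \in I & p.2 \in I].
  rewrite -{1}[p]swK mem_imset ?inE /=; last exact: inv_inj.
  by rewrite [(_ \in I) && _]andbC.
have := cardsUI S (sw @: S)%SET; rewrite cardS'.
have -> : (S :|: sw @: S)%SET = finset.setX I I.
  apply/setP => -[i j]; rewrite !inE S'E /=.
  by case: (i \in I); case: (j \in I); rewrite ?andbF ?orbF //= !andbT leq_total.
have -> : (S :&: sw @: S)%SET = [set (i, i) | i in I]%SET.
  apply/setP => -[i j]; rewrite !inE S'E /=; apply/idP/imsetP.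
    move=> /andP[/and3P[ij iI jI] /and3P[ji _ _]]; exists i => //.
    by congr pair; apply/val_inj/eqP; rewrite /= eqn_leq ij ji.
  by move=> [l lI [-> ->]]; rewrite leqnn lI.
rewrite cardsX card_imset => [|i j [] //] sumE.
by rewrite /tau mulnS addnC sumE addnn -muln2 mulnK.
Qed.

End PairCount.

Section RangeOfAdjoint.
Context {R : realType} {n m : nat}.
Variable A : 'Hom(sym R n, 'rV[R]_m).

(** The value of the adjoint at [y] only depends on the inner products of [y]
    with a basis of the range of [A]. *)
Lemma adjoint_span : exists B : 'I_(\dim (limg A)) -> 'M[R]_n,
  forall y, exists w, vsval (adjoint A y) = \sum_i w i *: B i.
Proof.
pose X := vbasis (limg A).
pose v a d : 'rV[R]_m := A (symmetrize (delta_mx a d)).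
exists (fun i => \matrix_(a, d) coord X i (v a d)) => y.
exists (fun i : 'I_(\dim (limg A)) => frob y X`_i); apply/matrixP => a d; rewrite summxE.
have vE : v a d = \sum_i coord X i (v a d) *: X`_i.
  by apply: coord_vbasis; rewrite memv_img ?memvf.
have -> : vsval (adjoint A y) a d = frob y (v a d) by rewrite mxE.
rewrite [in LHS]vE frob_sumr.
by apply: eq_bigr => i _; rewrite frobZr !mxE mulrC.
Qed.

(** The coordinates of the range of the adjoint are relabelled by elements of
    [S]; as [S] has more elements than the rank, some [p0] is left over, and
    this is the dimension that the exceptional costs lack. *)
Lemma adjoint_span_on (P : finType) (S : {set P}) :
  (\dim (limg A) < #|S|)%N ->
  exists (p0 : P) (B : P -> 'M[R]_n), [/\ p0 \in S, B p0 = 0 &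
    forall y, exists w, vsval (adjoint A y) = \sum_(p in S) w p *: B p].
Proof.
move=> ltS; have [B BP] := adjoint_span.
pose e (i : 'I_(\dim (limg A))) : P := enum_val (widen_ord (ltnW ltS) i).
have e_inj : injective e by move=> i j /enum_val_inj/(congr1 val)/= /val_inj.
have eS i : e i \in S by exact: enum_valP.
have [p0 p0S p0e] : exists2 p0, p0 \in S & p0 \notin codom e.
  apply: contrapT => nex; suff : (#|S| <= #|codom e|)%N.
    by rewrite card_codom // card_ord leqNgt ltS.
  apply: subset_leq_card; apply/fintype.subsetP => p pS.
  by apply: contrapT => /negP pe; apply: nex; exists p.
pose B' p := if [pick i | e i == p] is Some i then B i else 0.
have B'e i : B' (e i) = B i.
  rewrite /B'; case: pickP => [j /eqP/e_inj->//|/(_ i)].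
  by rewrite eqxx.
exists p0, B'; split=> // [|y].
  rewrite /B'; case: pickP => // i /eqP ei; case/negP: p0e.
  by rewrite -ei codom_f.
have [w ->] := BP y.
exists (fun p => if [pick i | e i == p] is Some i then w i else 0).
rewrite (bigID [pred p | p \in codom e]) /= [X in _ + X]big1 => [|p]; last first.
  move=> /andP[_ pe]; case: pickP => [i /eqP ei|_]; last by rewrite scale0r.
  by case/negP: pe; rewrite -ei codom_f.
rewrite addr0 (eq_bigl (fun p => p \in (e @: [set: _])%SET)) => [|p]; last first.
  apply/andP/imsetP => [[_ /codomP[i ->]]|[i _ ->]]; first by exists i; rewrite ?inE.
  by rewrite eS codom_f.
rewrite big_imset /=; last by move=> i j _ _; exact: e_inj.
apply: eq_big => [i|i _]; first by rewrite inE.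
rewrite B'e.
case: pickP => [j /eqP/e_inj->//|/(_ i)]; by rewrite eqxx.
Qed.

End RangeOfAdjoint.

Section KernelChart.
Context {R : realType} {n : nat} (I : {set 'I_n}).

(** The independent entries of a symmetric matrix are those (i, j) with
    [i <= j]. *)
Definition sorted_pair (a d : 'I_n) : 'I_n * 'I_n :=
  if (a <= d)%N then (a, d) else (d, a).

Definition sorted_entry (X : 'M[R]_n) a d : R :=
  X (sorted_pair a d).1 (sorted_pair a d).2.

(** A symmetric matrix [S] whose kernel projects onto the coordinates in [I] is
    determined by its entries off [I] and by a matrix [Z], with columns indexed
    by [I], that expresses a basis of the kernel: [S] maps the vector with
    I-part [e_i] and other entries [Z _ i] to 0.  Both are read from the entries
    of [X] that are not in [I x I]. *)
Definition kernel_chart (X : 'M[R]_n) (a d : 'I_n) : R :=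
  if a \in I then
    if d \in I then
      \sum_(a' | a' \notin I) \sum_(d' | d' \notin I)
        sorted_entry X a' a * sorted_entry X a' d' * sorted_entry X d' d
    else - \sum_(a' | a' \notin I) sorted_entry X a' a * sorted_entry X a' d
  else
    if d \in I then
      - \sum_(d' | d' \notin I) sorted_entry X a d' * sorted_entry X d' d
    else sorted_entry X a d.

(** Entries in [I x I] are free for other use: [kernel_chart] does not read
    them. *)
Definition chart_coords (S Z X0 : 'M[R]_n) : 'M[R]_n :=
  \matrix_(i, j) if i \in I then (if j \in I then X0 i j else Z j i)
                 else (if j \in I then Z i j else S i j).

Lemma kernel_chartE (S Z X0 : 'M[R]_n) : S^T = S ->
  (forall a i, i \in I -> S a i = - \sum_(d | d \notin I) S a d * Z d i) ->
  forall a d, kernel_chart (chart_coords S Z X0) a d = S a d.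
Proof.
move=> ST SZ; have Ssym a d : S a d = S d a by rewrite -{1}ST mxE.
set X := chart_coords S Z X0.
have sX a d : ~~ ((a \in I) && (d \in I)) -> sorted_entry X a d = X a d.
  rewrite /sorted_entry /sorted_pair; case: ifP => //= _.
  by rewrite !mxE; case: (a \in I); case: (d \in I).
have Xoo a d : a \notin I -> d \notin I -> sorted_entry X a d = S a d.
  by move=> aI dI; rewrite sX ?(negPf aI) // mxE (negPf aI) (negPf dI).
have Xoi a d : a \notin I -> d \in I -> sorted_entry X a d = Z a d.
  by move=> aI dI; rewrite sX ?(negPf aI) // mxE (negPf aI) dI.
move=> a d; rewrite /kernel_chart.
case: (boolP (a \in I)) => aI; case: (boolP (d \in I)) => dI.
- rewrite SZ // -sumrN exchange_big /=; apply: eq_bigr => d' d'I.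
  rewrite Ssym SZ // mulNr opprK mulr_suml; apply: eq_bigr => a' a'I.
  by rewrite (Xoo a' d') // !Xoi // (Ssym d' a'); ring.
- rewrite Ssym SZ //; congr (- _); apply: eq_bigr => a' a'I.
  by rewrite (Xoo a' d) // Xoi // (Ssym d a') mulrC.
- rewrite SZ //; congr (- _); apply: eq_bigr => d' d'I.
  by rewrite (Xoo a d') // Xoi.
- exact: Xoo.
Qed.

End KernelChart.

(** The rows of [W] indexed by [I] carry its rank, hence form an invertible matrix;
    dividing by this matrix makes them the identity and the other rows [Z]. *)
Lemma kernel_normal_form (R : realType) (n k : nat) (S : 'M[R]_n) (W : 'M[R]_(n, k)) :
  \rank W = k -> S *m W = 0 ->
  exists (I : {set 'I_n}) (Z : 'M[R]_n), #|I| = k /\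
    forall a i, i \in I -> S a i = - \sum_(d | d \notin I) S a d * Z d i.
Proof.
move=> rkW SW; have fW : row_full W by rewrite /row_full rkW.
pose f := fullrankfun fW.
have f_inj : injective f by exact: fullrankfun_inj.
pose W1 := rowsub f W.
have uW1 : W1 \in unitmx.
  exact: fullrowsub_unit.
pose V := W *m invmx W1.
have SV : S *m V = 0 by rewrite mulmxA SW mul0mx.
have fV j' j : V (f j') j = (j' == j)%:R.
  have -> : V (f j') j = (rowsub f V) j' j by rewrite [RHS]mxE.
  by rewrite /V -mul_rowsub_mx -/W1 mulmxV // mxE.
exists (f @: [set: _])%SET, (\matrix_(d, i) \sum_j V d j * (f j == i)%:R); split.
  by rewrite card_imset // cardsT card_ord.
move=> a _ /imsetP[j _ ->]; apply/eqP; rewrite -addr_eq0 addrC; apply/eqP.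
have /matrixP/(_ a j) := SV; rewrite !mxE (bigID [pred d | d \in (f @: [set: _])%SET]) /=.
rewrite big_imset /=; last by move=> ? ? _ _; exact: f_inj.
rewrite (eq_bigl xpredT) => [|j']; last by rewrite inE.
rewrite (bigD1 j) //= fV eqxx mulr1 big1 => [|j' j'j]; last first.
  by rewrite fV (negPf j'j) mulr0.
rewrite addr0 addrC => sum0; rewrite -[RHS]sum0; congr (_ + _).
apply: eq_bigr => d _; congr (_ * _); rewrite mxE (bigD1 j) //= eqxx mulr1 big1.
  by rewrite addr0.
by move=> j' j'j; rewrite (inj_eq f_inj) (negPf j'j) mulr0.
Qed.

Section ExceptionalCosts.
Context {R : realType} {q m : nat} {n k : 'I_q -> nat}.
Variable A : forall c, 'Hom(sym R (n c), 'rV[R]_m).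
Hypothesis n_gt0 : forall c, (0 < n c)%N.

Definition ordered_pairs c (I : {set 'I_(n c)}) : {set 'I_(n c) * 'I_(n c)} :=
  [set p : 'I_(n c) * 'I_(n c) | [&& (p.1 <= p.2)%N, p.1 \in I & p.2 \in I]]%SET.

Lemma kernel_chart_tame (T : finType) (D : pred T) (n0 : nat) (I : {set 'I_n0})
    (X : (T -> R) -> 'M[R]_n0) a d :
  (forall a d, ~~ ((a \in I) && (d \in I)) ->
     tame D (fun x => sorted_entry (X x) a d)) ->
  tame D (fun x => kernel_chart I (X x) a d).
Proof.
move=> tX; rewrite /kernel_chart.
case: (boolP (a \in I)) => aI; case: (boolP (d \in I)) => dI.
- apply: tame_sum => a' a'I; apply: tame_sum => d' d'I.
  by apply: tameM; [apply: tameM|]; apply: tX; rewrite ?(negPf a'I) ?(negPf d'I).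
- apply: tameN; apply: tame_sum => a' a'I.
  by apply: tameM; apply: tX; rewrite (negPf a'I).
- apply: tameN; apply: tame_sum => d' d'I.
  by apply: tameM; apply: tX; rewrite ?(negPf aI) ?(negPf d'I).
- by apply: tX; rewrite (negPf aI).
Qed.

(** The chart expresses the costs of the stratum through the coordinates other
    than one: those of the other blocks, those of the kernel chart, and, at
    positions in [I x I], the coordinates of the range of the adjoint, which
    are too few to fill these positions. *)
Lemma stratum_null (c0 : 'I_q) (I0 : {set 'I_(n c0)}) :
  (\dim (limg (A c0)) < tau #|I0|)%N ->
  lebesgue_null [set C : (forall c, sym R (n c)) | exists y (Z : 'M[R]_(n c0)),
    forall a i, i \in I0 -> (vsval (slack A C y c0) : 'M[R]_(n c0)) a i =
      - \sum_(d | d \notin I0) (vsval (slack A C y c0) : 'M[R]_(n c0)) a d * Z d i].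
Proof.
move=> ltr; have := adjoint_span_on (A := A c0) (S := ordered_pairs I0).
rewrite /ordered_pairs card_ordered_pairs => /(_ ltr)[p0 [B [p0I B0 spanB]]].
pose I : forall c, {set 'I_(n c)} := dfwith (fun c => finset.set0) c0 I0.
pose Bc : forall c, 'I_(n c) * 'I_(n c) -> 'M[R]_(n c) :=
  dfwith (fun c (_ : 'I_(n c) * 'I_(n c)) => 0 : 'M[R]_(n c)) c0 B.
pose t0 : coords := Tagged (fun c => ('I_(n c) * 'I_(n c))%type) p0.
pose D : pred (@coords q n) := [pred t | upper t & t != t0].
pose H c (X : 'M[R]_(n c)) a d : R :=
  \sum_(p in ordered_pairs (I c)) X p.1 p.2 * Bc c p a d + kernel_chart (I c) X a d.
pose mx (x : coords -> R) c : 'M[R]_(n c) := \matrix_(i, j) x (coord_at i j).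
pose h (t : coords) (x : coords -> R) : R :=
  H (tag t) (mx x (tag t)) (tagged t).1 (tagged t).2.
have t0P c (p : 'I_(n c) * 'I_(n c)) : coord_at p.1 p.2 = t0 ->
    [/\ p \in ordered_pairs (I c) & Bc c p = 0].
  rewrite /coord_at -surjective_pairing => pt0.
  have cc0 : c = c0 by have := congr1 tag pt0.
  move: p pt0; rewrite cc0 => p /eqP; rewrite /t0 eq_Tagged /= => /eqP ->.
  by rewrite /I /Bc !dfwithin.
apply: (lebesgue_null_sub (E' := [set X : (forall c, sym R (n c)) | exists x,
    forall c (i j : 'I_(n c)), (i <= j)%N ->
      (vsval (X c) : 'M[R]_(n c)) i j = h (coord_at i j) x])); last first.
  apply: (tame_image_null (n_gt0 c0) (D := D)).
    apply: proper_card; apply/properP; split.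
      by apply/fintype.subsetP => t /andP[].
    exists t0; last by rewrite inE /= eqxx andbF.
    by move: p0I; rewrite inE => /and3P[].
  move=> [c [a d]]; rewrite /h /H /=; apply: tameD.
    apply: tame_sum => p pI; have [pt0|pt0] := eqVneq (coord_at p.1 p.2) t0.
      have [_ ->] := t0P c p pt0.
      have -> : (fun x => mx x c p.1 p.2 * (0 : 'M[R]_(n c)) a d) = (fun=> 0).
        by apply/funext => x; rewrite [X in _ * X]mxE mulr0.
      exact: tame_cst.
    apply: tameM; last exact: tame_cst.
    have -> : (fun x => mx x c p.1 p.2) = (fun x => x (coord_at p.1 p.2)).
      by apply/funext => x; rewrite mxE.
    by apply: tame_coord; rewrite /D /= pt0 andbT; move: pI; rewrite inE => /andP[].
  apply: kernel_chart_tame => {a d} a d ad.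
  set p := sorted_pair a d.
  have -> : (fun x => sorted_entry (mx x c) a d) = (fun x => x (coord_at p.1 p.2)).
    by apply/funext => x; rewrite /sorted_entry mxE.
  apply: tame_coord; rewrite /D /=; apply/andP; split.
    rewrite /upper /= /p /sorted_pair; case: ifP => //= /negbT.
    by rewrite -ltnNge => /ltnW.
  apply/eqP => /t0P[+ _]; rewrite inE => /andP[_]; apply/negP.
  by move: ad; rewrite /p /sorted_pair; case: ifP => //= _; rewrite andbC.
move=> C [y [Z SZ]]; set S := vsval (slack A C y c0) in SZ.
have ST : S^T = S by apply/memv_symV/subvsP.
have [w wE] := spanB y.
pose X0 := chart_coords I0 S Z (\matrix_(i, j) w (i, j)).
pose Xc : forall c, 'M[R]_(n c) := dfwith (fun c => vsval (C c) : 'M[R]_(n c)) c0 X0.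
exists (fun t => Xc (tag t) (tagged t).1 (tagged t).2) => c i j ij.
rewrite /h /=; set X := mx _ c; have -> : X = Xc c.
  by apply/matrixP => a d; rewrite mxE.
rewrite /H; have [cc0|cc0] := eqVneq c c0; last first.
  have Ic : I c = finset.set0 by rewrite /I dfwithout // eq_sym.
  rewrite big1 => [|p]; last by rewrite inE Ic inE andbF.
  rewrite add0r /kernel_chart Ic !inE /sorted_entry /sorted_pair ij /=.
  by rewrite /Xc dfwithout // eq_sym.
subst c; rewrite /I /Bc /Xc !dfwithin /X0 kernel_chartE //.
have -> : vsval (C c0) = vsval (adjoint (A c0) y) + S.
  by rewrite /S /slack linearB /= addrC subrK.
rewrite mxE wE summxE; congr (_ + _); apply: eq_bigr => p.
by rewrite inE => /and3P[_ p1 p2]; rewrite !mxE p1 p2 -surjective_pairing.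
Qed.

(** Outside of this set the stationary factors are column-rank deficient in the
    blocks concerned: a factor block of full column rank would serve as [W]. *)
Definition exceptional_costs : set (forall c, sym R (n c)) :=
  [set C | exists c, (\dim (limg (A c)) < tau (k c))%N /\
    exists y (W : 'M[R]_(n c, k c)), \rank W = k c /\
      vsval (slack A C y c) *m W = 0].

Lemma exceptional_costs_null (q_gt0 : (0 < q)%N) : lebesgue_null exceptional_costs.
Proof.
pose c1 : 'I_q := Ordinal q_gt0.
pose E c (I : {set 'I_(n c)}) := [set C : (forall c, sym R (n c)) |
  (\dim (limg (A c)) < tau #|I|)%N /\ exists y (Z : 'M[R]_(n c)),
    forall a i, i \in I -> (vsval (slack A C y c) : 'M[R]_(n c)) a i =
      - \sum_(d | d \notin I) (vsval (slack A C y c) : 'M[R]_(n c)) a d * Z d i].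
apply: (@lebesgue_null_sub _ _ _ _ (\bigcup_c \bigcup_I E c I)).
  move=> C [c [ltr [y [W [rkW SW]]]]]; exists c => //.
  have [I [Z [cI SZ]]] := kernel_normal_form rkW SW.
  by exists I => //; split; [rewrite cI|exists y, Z].
apply: (lebesgue_null_bigcup (n_gt0 c1)) => c.
apply: (lebesgue_null_bigcup (n_gt0 c1)) => I.
have [ltr|ger] := ltnP (\dim (limg (A c))) (tau #|I|); last first.
  apply: lebesgue_null_sub (lebesgue_null0 (n_gt0 c1)) => C [+ _].
  by rewrite ltnNge ger.
by apply: lebesgue_null_sub (stratum_null ltr) => C [].
Qed.

Lemma critical_optimal_generic (b : 'rV[R]_m) (C : forall c, sym R (n c))
    (F : blocks R n k) :
  (forall c, (n c <= k c)%N \/ (\dim (limg (A c)) < tau (k c))%N) ->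
  ~ exceptional_costs C -> second_order_critical A b C F ->
  sdp_optimal A b C (bm_gram F).
Proof.
move=> kc notE crit; apply: critical_optimal => // c.
case: (kc c) => [|ltr]; [by left|right].
rewrite ltn_neqAle rank_leq_col andbT; apply/eqP => rkF; apply: notE.
by exists c; split=> //; exists (bm_mu A C F), (blk c F); split=> //; have [] := crit.
Qed.

End ExceptionalCosts.

Theorem theorem3 (R : realType) (q m : nat) (n k : 'I_q -> nat)
    (A : forall c, 'Hom(sym R (n c), 'rV[R]_m)) (b : 'rV[R]_m)
    (q_gt0 : (0 < q)%N) (m_gt0 : (0 < m)%N)
    (n_gt0 : forall c, (0 < n c)%N) (k_gt0 : forall c, (0 < k c)%N) :
  [/\ forall (C : forall c, sym R (n c)) (theta gamma : R)
        (omega zeta : nat -> R) (F : nat -> blocks R n k)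
        (y : nat -> 'rV[R]_m) (rho : nat -> R),
      fixed_rank_alm A b C theta gamma omega zeta F y rho ->
      forall Fstar : blocks R n k, accumulation_point F Fstar ->
        bm_constr A b Fstar = 0 /\ second_order_critical A b C Fstar,

      (forall c, (n c <= k c)%N \/ (\dim (limg (A c)) < tau (k c))%N) ->
      exists E : set (forall c, sym R (n c)),
        [/\ lebesgue_null E,
            forall C : forall c, sym R (n c), ~ E C ->
            forall F : blocks R n k, second_order_critical A b C F ->
              sdp_optimal A b C (bm_gram F) &
            forall (C : forall c, sym R (n c)) (theta gamma : R)
              (omega zeta : nat -> R) (F : nat -> blocks R n k)
              (y : nat -> 'rV[R]_m) (rho : nat -> R),
            ~ E C -> fixed_rank_alm A b C theta gamma omega zeta F y rho ->
              sdp_convergence A b C F] &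

      (forall c, (n c <= k c)%N) ->
      (forall (C : forall c, sym R (n c)) (F : blocks R n k),
         second_order_critical A b C F -> sdp_optimal A b C (bm_gram F)) /\
      (forall (C : forall c, sym R (n c)) (theta gamma : R)
         (omega zeta : nat -> R) (F : nat -> blocks R n k)
         (y : nat -> 'rV[R]_m) (rho : nat -> R),
       fixed_rank_alm A b C theta gamma omega zeta F y rho ->
         sdp_convergence A b C F)].
Proof.
(* On the compact set that contains the iterates, optimality of the second-order
   critical points is all that convergence needs. *)
have conv (C : forall c, sym R (n c)) theta gamma omega zeta
    (F : nat -> blocks R n k) y rho :
    (forall G : blocks R n k, second_order_critical A b C G ->
       sdp_optimal A b C (bm_gram G)) ->
    fixed_rank_alm A b C theta gamma omega zeta F y rho -> sdp_convergence A b C F.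
  move=> opt alm; have [_ _ [K [cK FK _]]] := alm_A1 alm.
  apply: accumulation_optimal_convergence cK FK _ => G accG.
  exact/opt/(alm_second_order_critical alm).
split.
- move=> C theta gamma omega zeta F y rho alm G accG.
  have crit := alm_second_order_critical alm accG.
  by split=> //; have [] := crit.
- move=> kc; exists (exceptional_costs (k := k) A); split.
  + exact: exceptional_costs_null.
  + by move=> C notE F; exact: critical_optimal_generic.
  + move=> C theta gamma omega zeta F y rho notE; apply: conv => G.
    exact: critical_optimal_generic.
- move=> nk; have opt (C : forall c, sym R (n c)) (F : blocks R n k) :
      second_order_critical A b C F -> sdp_optimal A b C (bm_gram F).
    by move=> crit; apply: critical_optimal => // c; left.
  by split=> // C theta gamma omega zeta F y rho; apply: conv => G; exact: opt.
Qed.
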